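(* Let $\Bbbk$ be a field, $H$ a Hopf $\Bbbk$-algebra, and $L$ a finite-dimensional Lie $\Bbbk$-algebra which is either a left $H$-module Lie algebra or a right $H$-comodule Lie algebra. Assume that the tensor algebra $TL$, with its induced $H$-(co)module structure, is co-hereditarily tracial, and that $\dim_{\Bbbk}\mathrm{alg}\langle \mathrm{ad}_L(L)\rangle<\mathrm{char}(\Bbbk)$ if $\mathrm{char}(\Bbbk)>0$. Then the nilradical $\mathfrak{n}(L)$ is $H$-invariant (in the module case), respectively $H$-coinvariant (in the comodule case).
   Context: $H$ has comultiplication $h\mapsto h_1\otimes h_2$ (Sweedler notation), counit $\varepsilon$ and antipode $S$. An $H$-(co)module Lie algebra is a Lie algebra that is a left $H$-module (right $H$-comodule) for which the bracket $L\otimes L\to L$ is an $H$-(co)module morphism, tensor products carrying the usual diagonal (co)actions. For a finite-dimensional $H$-(co)module $V$, $\mathrm{End}(V)\cong V\otimes V^*$ carries the induced (co)action, $V^*$ being the left dual: in the module case $(h\cdot T)(v)=h_1\cdot T(S(h_2)\cdot v)$; in the comodule case, writing coactions as $v\mapsto v_0\otimes v_1\in V\otimes H$, $T_0(v)\otimes T_1=T(v_0)_0\otimes T(v_0)_1S(v_1)$. $V$ is tracial if $\mathrm{Tr}:\mathrm{End}(V)\to\Bbbk$ is a morphism of $H$-(co)modules to the trivial (co)module $\Bbbk$. A possibly infinite-dimensional $H$-(co)module is co-hereditarily tracial if all of its finite-dimensional quotient (co)modules are tracial. $\mathrm{ad}_L:L\to\mathrm{End}(L)$, $\mathrm{ad}_L(x)=[x,-]$,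 is the adjoint representation, and $\mathrm{alg}\langle\mathrm{ad}_L(L)\rangle$ is the associative subalgebra of $\mathrm{End}(L)$ generated by $\mathrm{ad}_L(L)$, i.e. the image of the algebra morphism $TL\to \mathrm{End}(L)$ extending $\mathrm{ad}_L$. The nilradical $\mathfrak{n}(L)$ is the largest nilpotent ideal of $L$. A subspace $W\le L$ is $H$-invariant if $H\cdot W\subseteq W$, respectively $H$-coinvariant if the coaction $\rho$ satisfies $\rho(W)\subseteq W\otimes H$. *)

(* Defs.v *)
From HB Require Import structures.
From mathcomp Require Import all_boot all_order all_algebra.
From mathcomp Require Import boolp.

Set Implicit Arguments.
Unset Strict Implicit.
Unset Printing Implicit Defensive.

Import GRing.Theory.
Local Open Scope ring_scope.
Local Open Scope quotient_scope.

(* The k-vector space with generators [gen x], x : X, that is universal among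
   the families F : X -> W satisfying P.  It is the quotient of the formal
   linear combinations \sum c_i x_i, represented as sequences of pairs
   (c_i, x_i), by the combinations killed by every family satisfying P. *)
Section Presented.
Variables (k : fieldType) (X : choiceType).
Variable P : forall W : lmodType k, (X -> W) -> Prop.
Implicit Types (s t : seq (k * X)) (c : k).

Definition fsum (W : lmodType k) (F : X -> W) s : W :=
  \sum_(p <- s) p.1 *: F p.2.

Definition pres_eqv : rel (seq (k * X)) := fun s t =>
  `[< forall (W : lmodType k) (F : X -> W), P F -> fsum F s = fsum F t >].

Lemma pres_eqv_refl : reflexive pres_eqv.
Proof. by move=> s; apply/asboolP. Qed.

Lemma pres_eqv_sym : symmetric pres_eqv.
Proof.
by move=> s t; apply/asboolP/asboolP => h W F PF; rewrite (h W F PF).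
Qed.

Lemma pres_eqv_trans : transitive pres_eqv.
Proof.
move=> t s u /asboolP h1 /asboolP h2; apply/asboolP => W F PF.
by rewrite (h1 W F PF) (h2 W F PF).
Qed.

Canonical pres_equiv :=
  EquivRel pres_eqv pres_eqv_refl pres_eqv_sym pres_eqv_trans.

Definition pres : Type := {eq_quot pres_equiv}.
HB.instance Definition _ := Choice.on pres.
HB.instance Definition _ := EqQuotient.on pres.

Definition gen (x : X) : pres := \pi_pres [:: (1, x)].
Definition lift (W : lmodType k) (F : X -> W) (t : pres) : W :=
  fsum F (repr t).

Lemma liftpi (W : lmodType k) (F : X -> W) s :
  P F -> lift F (\pi_pres s) = fsum F s.
Proof.
move=> PF; rewrite /lift; case: piP => t /eqquotP /asboolP h.
by rewrite (h W F PF).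
Qed.

Lemma pres_ext (x y : pres) :
  (forall (W : lmodType k) (F : X -> W), P F -> lift F x = lift F y) -> x = y.
Proof.
move=> h; rewrite -[x]reprK -[y]reprK.
by apply/eqquotP/asboolP => W F PF; exact: h.
Qed.

Definition fscale c s := [seq (c * p.1, p.2) | p <- s].

Lemma fsum_cat (W : lmodType k) (F : X -> W) s t :
  fsum F (s ++ t) = fsum F s + fsum F t.
Proof. exact: big_cat. Qed.

Lemma fsum_scale (W : lmodType k) (F : X -> W) c s :
  fsum F (fscale c s) = c *: fsum F s.
Proof.
rewrite /fsum big_map scaler_sumr.
by apply: eq_bigr => p _; rewrite scalerA.
Qed.

Definition pres_zero : pres := \pi_pres [::].
Definition pres_add (x y : pres) : pres := \pi_pres (repr x ++ repr y).
Definition pres_scale c (x : pres) : pres := \pi_pres (fscale c (repr x)).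
Definition pres_opp (x : pres) : pres := pres_scale (-1) x.

Lemma lift_zero (W : lmodType k) (F : X -> W) : P F -> lift F pres_zero = 0.
Proof. by move=> PF; rewrite liftpi // /fsum big_nil. Qed.

Lemma lift_add (W : lmodType k) (F : X -> W) x y : P F ->
  lift F (pres_add x y) = lift F x + lift F y.
Proof. by move=> PF; rewrite liftpi // fsum_cat. Qed.

Lemma lift_scale (W : lmodType k) (F : X -> W) c x : P F ->
  lift F (pres_scale c x) = c *: lift F x.
Proof. by move=> PF; rewrite liftpi // fsum_scale. Qed.

Fact pres_addA : associative pres_add.
Proof. by move=> x y z; apply: pres_ext => W F PF; rewrite !lift_add // addrA. Qed.

Fact pres_addC : commutative pres_add.
Proof. by move=> x y; apply: pres_ext => W F PF; rewrite !lift_add // addrC. Qed.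

Fact pres_add0 : left_id pres_zero pres_add.
Proof.
by move=> x; apply: pres_ext => W F PF; rewrite lift_add // lift_zero // add0r.
Qed.

Fact pres_addN : left_inverse pres_zero pres_opp pres_add.
Proof.
move=> x; apply: pres_ext => W F PF.
by rewrite lift_add // lift_scale // lift_zero // scaleN1r addNr.
Qed.

HB.instance Definition _ :=
  GRing.isZmodule.Build pres pres_addA pres_addC pres_add0 pres_addN.

Fact pres_scaleA a b x : pres_scale a (pres_scale b x) = pres_scale (a * b) x.
Proof. by apply: pres_ext => W F PF; rewrite !lift_scale // scalerA. Qed.

Fact pres_scale1 : left_id 1 pres_scale.
Proof. by move=> x; apply: pres_ext => W F PF; rewrite lift_scale // scale1r. Qed.

Fact pres_scaleDr : right_distributive pres_scale +%R.
Proof.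
move=> a x y; apply: pres_ext => W F PF.
by rewrite lift_scale // !lift_add // !lift_scale // scalerDr.
Qed.

Fact pres_scaleDl x : {morph pres_scale^~ x : a b / a + b}.
Proof.
move=> a b; apply: pres_ext => W F PF.
by rewrite lift_add // !lift_scale // scalerDl.
Qed.

HB.instance Definition _ := GRing.Zmodule_isLmodule.Build k pres
  pres_scaleA pres_scale1 pres_scaleDr pres_scaleDl.

Lemma lift_linear (W : lmodType k) (F : X -> W) : P F -> linear (lift F).
Proof. by move=> PF c x y; rewrite lift_add // lift_scale. Qed.

Lemma lift_gen (W : lmodType k) (F : X -> W) x : P F -> lift F (gen x) = F x.
Proof. by move=> PF; rewrite liftpi // /fsum big_seq1 scale1r. Qed.

Lemma lift_sum (W : lmodType k) (F : X -> W) (I : Type) (r : seq I)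
  (G : I -> pres) : P F ->
  lift F (\sum_(i <- r) G i) = \sum_(i <- r) lift F (G i).
Proof.
move=> PF; apply: (big_morph (lift F)); last exact: lift_zero.
by move=> x y; exact: lift_add.
Qed.

Lemma pres_repr (x : pres) : x = \sum_(p <- repr x) p.1 *: gen p.2.
Proof.
apply: pres_ext => W F PF; rewrite lift_sum //; apply: eq_bigr => p _.
by rewrite lift_scale // lift_gen.
Qed.

Lemma pres_linear_ext (W : lmodType k) (f g : pres -> W) :
  linear f -> linear g -> (forall x, f (gen x) = g (gen x)) -> f =1 g.
Proof.
move=> lf lg fg.
pose f' : {linear pres -> W} :=
  HB.pack f (GRing.isLinear.Build k pres W *:%R f lf).
pose g' : {linear pres -> W} :=
  HB.pack g (GRing.isLinear.Build k pres W *:%R g lg).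
move=> x; rewrite -[f x]/(f' x) -[g x]/(g' x) (pres_repr x) !linear_sum.
by apply: eq_bigr => p _; rewrite !linearZ /= fg.
Qed.

End Presented.

Section TensorProduct.
Variable k : fieldType.

Definition bilin (U V W : lmodType k) (f : U -> V -> W) : Prop :=
  (forall v, linear (f^~ v)) /\ (forall u, linear (f u)).

Definition tens (U V : lmodType k) : lmodType k :=
  pres (fun (W : lmodType k) (F : U * V -> W) => bilin (fun u v => F (u, v))).

Definition ten (U V : lmodType k) (u : U) (v : V) : tens U V := gen _ (u, v).

(* For t = \sum_i u_i (x) v_i, this is \sum_i f u_i v_i; it is meant for
   bilinear f, for which the result does not depend on the decomposition. *)
Definition tlift (U V W : lmodType k) (f : U -> V -> W) (t : tens U V) : W :=
  lift (fun p => f p.1 p.2) t.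

Definition tmap (U U' V V' : lmodType k) (f : U -> U') (g : V -> V') :
    tens U V -> tens U' V' :=
  tlift (fun u v => ten (f u) (g v)).

Definition tassoc (U V W : lmodType k) :
    tens (tens U V) W -> tens U (tens V W) :=
  tlift (fun t w => tlift (fun u v => ten u (ten v w)) t).

Lemma ten_bilin (U V : lmodType k) : bilin (@ten U V).
Proof.
split=> [v a u u'|u a v v']; apply: pres_ext => W F PF.
  by rewrite (lift_linear PF) !lift_gen //; case: (PF) => + _; apply.
by rewrite (lift_linear PF) !lift_gen //; case: (PF) => _; apply.
Qed.

Lemma tlift_linear (U V W : lmodType k) (f : U -> V -> W) :
  bilin f -> linear (tlift f).
Proof. exact: lift_linear. Qed.

Lemma tlift_ten (U V W : lmodType k) (f : U -> V -> W) u v :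
  bilin f -> tlift f (ten u v) = f u v.
Proof. by move=> bf; rewrite /tlift lift_gen. Qed.

Lemma tens_linear_ext (U V W : lmodType k) (f g : tens U V -> W) :
  linear f -> linear g -> (forall u v, f (ten u v) = g (ten u v)) -> f =1 g.
Proof. by move=> lf lg h; apply: pres_linear_ext => // -[u v]; exact: h. Qed.

Lemma tlift_linear_fun (U V W : lmodType k) (f g : U -> V -> W) a t :
  tlift (fun u v => a *: f u v + g u v) t = a *: tlift f t + tlift g t.
Proof.
rewrite /tlift /lift /fsum scaler_sumr -big_split.
by apply: eq_bigr => p _; rewrite scalerDr !scalerA mulrC.
Qed.

Lemma eq_tlift (U V W : lmodType k) (f g : U -> V -> W) t :
  f =2 g -> tlift f t = tlift g t.
Proof. by move=> fg; apply: eq_bigr => p _; rewrite fg. Qed.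

Lemma linear_tlift (U V W W' : lmodType k) (f : U -> V -> W) (g : W -> W') t :
  linear g -> g (tlift f t) = tlift (fun u v => g (f u v)) t.
Proof.
move=> lg; pose g' : {linear W -> W'} :=
  HB.pack g (GRing.isLinear.Build k W W' *:%R g lg).
rewrite -[LHS]/(g' _) linear_sum.
by apply: eq_bigr => p _; rewrite linearZ.
Qed.

End TensorProduct.

Section TensorAlgebra.
Variables (k : fieldType) (L : lmodType k).

(* The word [:: x_1; ...; x_n] stands for the tensor x_1 (x) ... (x) x_n; words
   of length n span the degree n part of the tensor algebra. *)
Definition multilin (W : lmodType k) (F : seq L -> W) : Prop :=
  forall s1 s2 a x y,
    F (s1 ++ (a *: x + y) :: s2) = a *: F (s1 ++ x :: s2) + F (s1 ++ y :: s2).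

Definition tensalg : lmodType k := pres multilin.

Definition word (s : seq L) : tensalg := gen multilin s.

Definition tcons (x : L) (t : tensalg) : tensalg :=
  lift (fun s => word (x :: s)) t.

Lemma word_multilin : multilin word.
Proof.
move=> s1 s2 a x y; apply: pres_ext => W F PF.
by rewrite (lift_linear PF) !lift_gen.
Qed.

Lemma cons_multilin (W : lmodType k) (F : seq L -> W) x :
  multilin F -> multilin (fun s => F (x :: s)).
Proof. by move=> PF s1 s2 a y z; exact: (PF (x :: s1)). Qed.

Lemma tcons_word x s : tcons x (word s) = word (x :: s).
Proof. by rewrite /tcons lift_gen //; exact/cons_multilin/word_multilin. Qed.

Lemma tcons_bilin : bilin tcons.
Proof.
split=> [t a x y|x]; last exact/lift_linear/cons_multilin/word_multilin.
rewrite /tcons /lift /fsum scaler_sumr -big_split.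
apply: eq_bigr => p _; rewrite (word_multilin [::]).
by rewrite scalerDr !scalerA mulrC.
Qed.

End TensorAlgebra.

Record hopfAlg (k : fieldType) := HopfAlg {
  hopf_alg :> algType k;
  comul : {linear hopf_alg -> tens hopf_alg hopf_alg};
  counit : {linear hopf_alg -> k^o};
  antipode : {linear hopf_alg -> hopf_alg};
  comulA : forall h,
    tassoc (tmap comul id (comul h)) = tmap id comul (comul h);
  counit_comull : forall h,
    tlift (fun h1 h2 => (counit h1 : k) *: h2) (comul h) = h;
  counit_comulr : forall h,
    tlift (fun h1 h2 => (counit h2 : k) *: h1) (comul h) = h;
  comul1 : comul 1 = ten 1 1;
  comulM : forall g h, comul (g * h) =
    tlift (fun g1 g2 => tlift (fun h1 h2 => ten (g1 * h1) (g2 * h2)) (comul h))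
          (comul g);
  counit1 : counit 1 = 1;
  counitM : forall g h, counit (g * h) = counit g * counit h;
  antipodel : forall h,
    tlift (fun h1 h2 => antipode h1 * h2) (comul h) = (counit h : k)%:A;
  antipoder : forall h,
    tlift (fun h1 h2 => h1 * antipode h2) (comul h) = (counit h : k)%:A }.

Arguments comul {k _}.
Arguments counit {k _}.
Arguments antipode {k _}.

Definition endtr (k : fieldType) (V : vectType k) (T : 'End(V)) : k^o :=
  \tr (passmx.mxof (vbasis {:V}) (vbasis {:V}) T).

Section Modules.
Variables (k : fieldType) (H : hopfAlg k).

Record hmodule (V : lmodType k) (act : H -> V -> V) : Prop := HModule {
  hact_linear : bilin act;
  hact1 : forall v, act 1 v = v;
  hactM : forall g h v, act (g * h) v = act g (act h v) }.

Definition hmod_morph (U V : lmodType k) (actU : H -> U -> U)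
    (actV : H -> V -> V) (f : U -> V) : Prop :=
  linear f /\ forall h u, f (actU h u) = actV h (f u).

Definition triv_act (h : H) (c : k^o) : k^o := counit h * c.

Definition tens_act (U V : lmodType k) (actU : H -> U -> U)
    (actV : H -> V -> V) (h : H) : tens U V -> tens U V :=
  tlift (fun u v => tlift (fun h1 h2 => ten (actU h1 u) (actV h2 v)) (comul h)).

Definition end_act (V : vectType k) (act : H -> V -> V) (h : H) (T : 'End(V)) :
    'End(V) :=
  tlift (fun h1 h2 => linfun (fun v => act h1 (T (act (antipode h2) v))))
        (comul h).

Fixpoint word_act (L : lmodType k) (act : H -> L -> L) (h : H) (s : seq L) :
    tensalg L :=
  if s is x :: s' then
    tlift (fun h1 h2 => tcons (act h1 x) (word_act act h2 s')) (comul h)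
  else (counit h : k) *: word [::].

Definition tensalg_act (L : lmodType k) (act : H -> L -> L) (h : H) :
    tensalg L -> tensalg L :=
  lift (word_act act h).

Definition hmod_tracial (V : vectType k) (act : H -> V -> V) : Prop :=
  hmod_morph (end_act act) triv_act (@endtr k V).

Definition hmod_cohereditarily_tracial (M : lmodType k) (act : H -> M -> M) :
    Prop :=
  forall (V : vectType k) (actV : H -> V -> V), hmodule actV ->
  forall p : M -> V, hmod_morph act actV p -> (forall v, exists m, p m = v) ->
  hmod_tracial actV.

Definition hinvariant (L : vectType k) (act : H -> L -> L) (W : {vspace L}) :
    Prop :=
  forall h w, w \in W -> act h w \in W.

End Modules.

Section Comodules.
Variables (k : fieldType) (H : hopfAlg k).

Record hcomodule (V : lmodType k) (rho : V -> tens V H) : Prop := HComodule {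
  coact_linear : linear rho;
  coactA : forall v,
    tassoc (tmap rho id (rho v)) = tmap id comul (rho v);
  coact_counit : forall v,
    tlift (fun v0 v1 => (counit v1 : k) *: v0) (rho v) = v }.

Definition hcomod_morph (U V : lmodType k) (rhoU : U -> tens U H)
    (rhoV : V -> tens V H) (f : U -> V) : Prop :=
  linear f /\ forall u, rhoV (f u) = tmap f id (rhoU u).

Definition triv_coact (c : k^o) : tens k^o H := ten c 1.

Definition tens_coact (U V : lmodType k) (rhoU : U -> tens U H)
    (rhoV : V -> tens V H) : tens U V -> tens (tens U V) H :=
  tlift (fun u v =>
    tlift (fun u0 u1 => tlift (fun v0 v1 => ten (ten u0 v0) (u1 * v1)) (rhoV v))
          (rhoU u)).

(* v |-> T(v_0)_0 (x) T(v_0)_1 S(v_1) *)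
Definition conj_coact (V : vectType k) (rho : V -> tens V H) (T : 'End(V))
    (v : V) : tens V H :=
  tlift (fun v0 v1 =>
    tlift (fun w0 w1 => ten w0 (w1 * antipode v1)) (rho (T v0)))
        (rho v).

(* The element T_0 (x) T_1 of End(V) (x) H determined by
   T_0(v) (x) T_1 = T(v_0)_0 (x) T(v_0)_1 S(v_1), see end_coactP, written in
   terms of a basis (e_i) of V and of its dual basis. *)
Definition end_coact (V : vectType k) (rho : V -> tens V H) (T : 'End(V)) :
    tens 'End(V) H :=
  \sum_i tlift
    (fun w h => ten (linfun (fun v => coord (vbasis {:V}) i v *: w)) h)
    (conj_coact rho T (vbasis {:V})`_i).

Fixpoint word_coact (L : lmodType k) (rho : L -> tens L H) (s : seq L) :
    tens (tensalg L) H :=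
  if s is x :: s' then
    tlift (fun x0 x1 =>
      tlift (fun t0 t1 => ten (tcons x0 t0) (x1 * t1)) (word_coact rho s'))
          (rho x)
  else ten (word [::]) 1.

Definition tensalg_coact (L : lmodType k) (rho : L -> tens L H) :
    tensalg L -> tens (tensalg L) H :=
  lift (word_coact rho).

Definition hcomod_tracial (V : vectType k) (rho : V -> tens V H) : Prop :=
  hcomod_morph (end_coact rho) triv_coact (@endtr k V).

Definition hcomod_cohereditarily_tracial (M : lmodType k)
    (rho : M -> tens M H) : Prop :=
  forall (V : vectType k) (rhoV : V -> tens V H), hcomodule rhoV ->
  forall p : M -> V, hcomod_morph rho rhoV p -> (forall v, exists m, p m = v) ->
  hcomod_tracial rhoV.

(* The image of W (x) H in L (x) H is that of vsval (x) id. *)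
Definition hcoinvariant (L : vectType k) (rho : L -> tens L H)
    (W : {vspace L}) : Prop :=
  forall w, w \in W ->
  exists t : tens (subvs_of W) H, rho w = tmap vsval id t.

End Comodules.

Record lieAlg (k : fieldType) := LieAlg {
  lie_space :> vectType k;
  bracket : lie_space -> lie_space -> lie_space;
  bracket_bilin : bilin bracket;
  bracketxx : forall x, bracket x x = 0;
  jacobi : forall x y z, bracket x (bracket y z) + bracket y (bracket z x)
    + bracket z (bracket x y) = 0 }.

Section Extrema.
Variables (k : fieldType) (V : vectType k) (P : {vspace V} -> Prop).

Lemma exists_least_vspace :
  P fullv -> (forall U W, P U -> P W -> P (U :&: W)%VS) ->
  exists U, P U /\ forall W, P W -> (U <= W)%VS.
Proof.
move=> Pfull Pcap.
have exd : exists n, `[< exists U, P U /\ \dim U = n >].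
  by exists (\dim {:V}); apply/asboolP; exists fullv.
have [U [PU dU]] : exists U, P U /\ \dim U = ex_minn exd.
  by case: ex_minnP => n /asboolP.
exists U; split=> // W PW; apply/capv_idPl/eqP.
rewrite eqEdim capvSl /= dU; case: ex_minnP => n _; apply.
by apply/asboolP; exists (U :&: W)%VS; split=> //; exact: Pcap.
Qed.

Lemma exists_greatest_vspace :
  P 0%VS -> (forall U W, P U -> P W -> P (U + W)%VS) ->
  exists U, P U /\ forall W, P W -> (W <= U)%VS.
Proof.
move=> P0 Padd.
have exd : exists n, `[< exists U, P U /\ \dim U = n >].
  by exists 0; apply/asboolP; exists 0%VS; split=> //; exact: dimv0.
have bd n : `[< exists U, P U /\ \dim U = n >] -> (n <= \dim {:V})%N.
  by move=> /asboolP[U [_ <-]]; exact: dimvS (subvf _).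
have [U [PU dU]] : exists U, P U /\ \dim U = ex_maxn exd bd.
  by case: ex_maxnP => n /asboolP.
exists U; split=> // W PW.
suff -> : U = (U + W)%VS by exact: addvSr.
apply/eqP; rewrite eqEdim addvSl /= dU; case: ex_maxnP => n _; apply.
by apply/asboolP; exists (U + W)%VS; split=> //; exact: Padd.
Qed.

End Extrema.

Section Lie.
Variables (k : fieldType) (L : lieAlg k).
Implicit Types (U V W I J : {vspace L}) (x y z : L).

Definition brackv U V : {vspace L} :=
  <<[seq bracket x y | x <- vbasis U, y <- vbasis V]>>%VS.

Definition lie_ideal I : bool := (brackv fullv I <= I)%VS.

Definition lcs I n : {vspace L} := iter n (brackv I) I.

Definition lie_nilpotent I : Prop := exists n, lcs I n = 0%VS.

Definition nilpotent_ideal I : Prop := lie_ideal I /\ lie_nilpotent I.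

Definition bracketl x : {linear L -> L} := HB.pack (bracket x)
  (GRing.isLinear.Build k L L *:%R (bracket x) ((bracket_bilin L).2 x)).

Definition bracketr y : {linear L -> L} := HB.pack (fun x : L => bracket x y)
  (GRing.isLinear.Build k L L *:%R (fun x : L => bracket x y)
    ((bracket_bilin L).1 y)).

Lemma brackvP U V W :
  reflect (forall x y, x \in U -> y \in V -> bracket x y \in W)
          (brackv U V <= W)%VS.
Proof.
apply: (iffP span_subvP) => h.
  move=> x y xU yV; rewrite (coord_vbasis xU) -[bracket _ _]/(bracketr y _).
  rewrite linear_sum; apply: memv_suml => i _; rewrite linearZ; apply: memvZ.
  rewrite (coord_vbasis yV) /= -[bracket _ _]/(bracketl _ _) linear_sum.
  apply: memv_suml => j _; rewrite linearZ; apply: memvZ => /=; apply: h.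
  by apply/allpairsP; exists ((vbasis U)`_i, (vbasis V)`_j); split=> //=;
    apply: mem_nth; rewrite size_tuple.
move=> z /allpairsP[[x y] /= [xU yV ->]].
by apply: h; exact: vbasis_mem.
Qed.

Lemma mem_brackv U V x y : x \in U -> y \in V -> bracket x y \in brackv U V.
Proof. by move: x y; apply/brackvP. Qed.

Lemma lie_idealP I :
  reflect (forall x y, y \in I -> bracket x y \in I) (lie_ideal I).
Proof.
apply: (iffP (brackvP _ _ _)) => h x y; first by move=> yI; exact: h (memvf _) yI.
by move=> _; exact: h.
Qed.

Lemma bracketC x y : bracket x y = - bracket y x.
Proof.
have := bracketxx (x + y).
rewrite -[bracket _ _]/(bracketl _ _) linearD /= -2![bracket (x + y) _]/(bracketr _ _).
rewrite !linearD /= !bracketxx add0r addr0 => /eqP.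
by rewrite addrC addr_eq0 => /eqP.
Qed.

Lemma jacobi_der x y z :
  bracket x (bracket y z) = bracket (bracket x y) z + bracket y (bracket x z).
Proof.
have /eqP := jacobi x y z; rewrite -addrA addr_eq0 => /eqP ->.
rewrite opprD addrC (bracketC z) opprK; congr (_ + _).
by rewrite (bracketC z x) -[bracket y _]/(bracketl y _) linearN opprK.
Qed.

Lemma lie_ideal_brackv I J :
  lie_ideal I -> lie_ideal J -> lie_ideal (brackv I J).
Proof.
move=> /lie_idealP iI /lie_idealP iJ; apply/lie_idealP => x w.
have lin : linear (bracket x) := (bracket_bilin L).2 x.
suff /subvP h : (brackv I J <= linfun (bracketl x) @^-1: brackv I J)%VS.
  by move=> /h; rewrite -memv_preim lfunE.
apply/brackvP => y z yI zJ; rewrite -memv_preim lfunE /= jacobi_der.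
by apply: memvD; apply: mem_brackv; rewrite ?iI ?iJ.
Qed.

Lemma lie_ideal_lcs I n : lie_ideal I -> lie_ideal (lcs I n).
Proof. by move=> iI; elim: n => //= n; exact: lie_ideal_brackv. Qed.

Lemma lie_idealD I J : lie_ideal I -> lie_ideal J -> lie_ideal (I + J)%VS.
Proof.
move=> /lie_idealP iI /lie_idealP iJ; apply/lie_idealP => x _ /memv_addP[u uI [v vJ ->]].
by rewrite -[bracket _ _]/(bracketl _ _) linearD memv_add ?iI ?iJ.
Qed.

Let lcs' I n : {vspace L} := if n is n'.+1 then lcs I n' else fullv.

Let lcs'_ideal I n : lie_ideal I -> lie_ideal (lcs' I n).
Proof.
case: n => [|n]; last exact: lie_ideal_lcs.
by move=> _; apply/lie_idealP => *; exact: memvf.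
Qed.

Let lcs'_br I n x y : lie_ideal I ->
  x \in I -> y \in lcs' I n -> bracket x y \in lcs' I n.+1.
Proof.
move=> iI xI; case: n => [_|n yI]; last exact: mem_brackv.
by rewrite bracketC memvN; apply: (lie_idealP _ iI).
Qed.

Let lcs'0 I p n : lcs I p = 0%VS -> (p < n)%N -> lcs' I n = 0%VS.
Proof.
move=> Ip; case: n => // n; rewrite ltnS => /subnK <-.
rewrite /= /lcs iterD -/(lcs I p) Ip; elim: (n - p)%N => //= m ->.
apply/eqP; rewrite -subv0; apply/brackvP => x y _.
rewrite memv0 => /eqP ->; rewrite -[bracket _ _]/(bracketl _ _) linear0.
exact: mem0v.
Qed.

Lemma nilpotent_idealD I J :
  nilpotent_ideal I -> nilpotent_ideal J -> nilpotent_ideal (I + J)%VS.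
Proof.
move=> [iI [p Ip]] [iJ [q Jq]]; split; first exact: lie_idealD.
have sub n : (lcs (I + J) n <=
    \sum_(a < n.+2) (lcs' I a :&: lcs' J (n.+1 - a)))%VS.
  elim: n => [|n IHn].
    rewrite big_ord_recl big_ord1 /= capfv capvf addvC.
    exact: subvv.
  rewrite /= -/(lcs _ _); apply/brackvP => x y xIJ /(subvP IHn).
  move=> /memv_sumP[w wP ->]; rewrite -[bracket _ _]/(bracketl _ _) linear_sum.
  apply: memv_suml => a _; have := wP a isT; rewrite memv_cap => /andP[wI wJ].
  have {xIJ} /memv_addP[u uI [v vJ ->]] := xIJ.
  rewrite [bracketl _ _]/= -[bracket _ _]/(bracketr _ _) linearD /=.
  apply: memvD.
    have lt : (a.+1 < n.+3)%N by rewrite ltnS ltn_ord.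
    apply: (subvP (sumv_sup (Ordinal lt) isT (subvv _))).
    rewrite memv_cap /= subSS; apply/andP; split.
      exact: (@lcs'_br I a).
    by apply: (lie_idealP _ (lcs'_ideal _ iJ)).
  have lt : (a < n.+3)%N by rewrite (leq_trans (ltn_ord a)).
  apply: (subvP (sumv_sup (Ordinal lt) isT (subvv _))).
  rewrite memv_cap /= subSn; last by rewrite -ltnS ltn_ord.
  apply/andP; split; last exact: lcs'_br.
  by apply: (lie_idealP _ (lcs'_ideal _ iI)).
exists (p + q)%N; apply/eqP; rewrite -subv0 (subv_trans (sub _)) //.
apply/subv_sumP => a _; case: (ltnP p a) => [lt|le].
  by rewrite (lcs'0 Ip lt) cap0v.
rewrite (lcs'0 Jq) ?capv0 //.
by rewrite ltn_subRL ltnS leq_add2r.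
Qed.

Lemma nilradical_exists :
  exists N, nilpotent_ideal N /\ forall I, nilpotent_ideal I -> (I <= N)%VS.
Proof.
apply: exists_greatest_vspace; last exact: nilpotent_idealD.
split; last by exists 0.
apply/lie_idealP => x y; rewrite memv0 => /eqP ->.
by rewrite -[bracket _ _]/(bracketl _ _) linear0 mem0v.
Qed.

Definition nilradical : {vspace L} := sval (cid nilradical_exists).

Lemma nilradicalP : nilpotent_ideal nilradical /\
  forall I, nilpotent_ideal I -> (I <= nilradical)%VS.
Proof. exact: svalP (cid nilradical_exists). Qed.

Definition ad x : 'End(L) := linfun (bracket x).

Lemma adE x y : ad x y = bracket x y.
Proof. exact: (lfunE (bracketl x)). Qed.

Definition ad_subalg (A : {vspace 'End(L)}) : Prop :=
  [/\ \1%VF \in A, forall f g, f \in A -> g \in A -> (f \o g)%VF \in A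
    & forall x, ad x \in A].

Lemma ad_alg_exists :
  exists A, ad_subalg A /\ forall B, ad_subalg B -> (A <= B)%VS.
Proof.
apply: exists_least_vspace; first by split=> *; exact: memvf.
move=> A B [A1 AM Aad] [B1 BM Bad].
split; first by rewrite memv_cap A1.
  move=> f g; rewrite !memv_cap => /andP[fA fB] /andP[gA gB].
  by rewrite AM ?BM.
by move=> x; rewrite memv_cap Aad Bad.
Qed.

(* The unital associative subalgebra of End(L) generated by ad(L), that is, the
   image of the tensor algebra of L. *)
Definition ad_alg : {vspace 'End(L)} := sval (cid ad_alg_exists).

Lemma ad_algP : ad_subalg ad_alg /\ forall B, ad_subalg B -> (ad_alg <= B)%VS.
Proof. exact: svalP (cid ad_alg_exists). Qed.

End Lie.

Definition hmodule_lie (k : fieldType) (H : hopfAlg k) (L : lieAlg k)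
    (act : H -> L -> L) : Prop :=
  hmodule act /\ hmod_morph (tens_act act act) act (tlift (@bracket k L)).

Definition hcomodule_lie (k : fieldType) (H : hopfAlg k) (L : lieAlg k)
    (rho : L -> tens L H) : Prop :=
  hcomodule rho /\ hcomod_morph (tens_coact rho rho) rho (tlift (@bracket k L)).

Section BilinFacts.
Variable k : fieldType.
Implicit Types (A B U V W X Y : lmodType k).

Lemma linear_comp U V W (f : V -> W) (g : U -> V) :
  linear f -> linear g -> linear (fun u => f (g u)).
Proof. by move=> lf lg a x y; rewrite lg lf. Qed.

Lemma linear_scale U V (f : U -> V) a u : linear f -> f (a *: u) = a *: f u.
Proof.
move=> lf; pose f' : {linear U -> V} :=
  HB.pack f (GRing.isLinear.Build k U V *:%R f lf).
by rewrite -[f (a *: u)]/(f' (a *: u)) linearZ.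
Qed.

Lemma tlift_exchange U V X Y W (F : U -> V -> X -> Y -> W) t t' :
  tlift (fun u v => tlift (F u v) t') t =
  tlift (fun x y => tlift (fun u v => F u v x y) t) t'.
Proof.
rewrite /tlift /lift /fsum; under eq_bigr do rewrite scaler_sumr.
rewrite exchange_big /=; apply: eq_bigr => q _; rewrite scaler_sumr.
by apply: eq_bigr => p _; rewrite !scalerA mulrC.
Qed.

Lemma linear_id U : linear (fun u : U => u).
Proof. by []. Qed.

Lemma bilin_comp A B U V W (f : U -> V -> W) (g : A -> U) (h : B -> V) :
  bilin f -> linear g -> linear h -> bilin (fun a b => f (g a) (h b)).
Proof.
move=> [fl fr] lg lh; split=> [b|a].
  exact: (linear_comp (fl _) lg).
exact: (linear_comp (fr _) lh).
Qed.

Lemma linear_bilin A B W X (f : W -> X) (g : A -> B -> W) :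
  linear f -> bilin g -> bilin (fun a b => f (g a b)).
Proof.
move=> lf [gl gr]; split=> [b|a]; first exact: (linear_comp lf (gl b)).
exact: (linear_comp lf (gr a)).
Qed.

Lemma linear_tlift_fun A U V W (F : A -> U -> V -> W) t :
  (forall u v, linear (fun a => F a u v)) -> linear (fun a => tlift (F a) t).
Proof.
by move=> lF c x y; rewrite -tlift_linear_fun; apply: eq_tlift => u v; rewrite lF.
Qed.

Lemma bilin_tlift_fun A B U V W (F : A -> B -> U -> V -> W) t :
  (forall u v, bilin (fun a b => F a b u v)) ->
  bilin (fun a b => tlift (F a b) t).
Proof.
move=> bF; split=> [b|a]; apply: linear_tlift_fun => u v.
  exact: (bF u v).1.
exact: (bF u v).2.
Qed.

Lemma tmap_linear U V X Y (f : U -> X) (g : V -> Y) :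
  linear f -> linear g -> linear (tmap f g).
Proof. by move=> lf lg; exact/tlift_linear/(bilin_comp (ten_bilin _ _)). Qed.

Lemma tmap_ten U V X Y (f : U -> X) (g : V -> Y) u v :
  linear f -> linear g -> tmap f g (ten u v) = ten (f u) (g v).
Proof.
by move=> lf lg; rewrite /tmap tlift_ten //; exact: (bilin_comp (ten_bilin _ _)).
Qed.

Lemma lfun_linear V W (T : {linear V -> W}) : linear T.
Proof. by move=> a x y; rewrite linearP. Qed.

Lemma ev_linear (V W : vectType k) (v : V) :
  linear (fun T : 'Hom(V, W) => T v).
Proof. by move=> a S T; rewrite !lfunE /= lfunE. Qed.

Lemma algmul_bilin (R : algType k) : bilin (fun x y : R => x * y).
Proof.
by split=> [y a x x'|x a y y']; rewrite ?mulrDl ?mulrDr -?scalerAl -?scalerAr.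
Qed.

Lemma linear_scaler V W (f : V -> W) c : linear f -> linear (fun v => c *: f v).
Proof. by move=> lf a x y; rewrite lf scalerDr !scalerA mulrC. Qed.

Lemma tassoc_ten U V W u v w :
  @tassoc k U V W (ten (ten u v) w) = ten u (ten v w).
Proof.
have b1 (w' : W) : bilin (fun (u : U) (v : V) => ten u (ten v w')).
  by apply: (bilin_comp (ten_bilin _ _)) => //; exact: ((ten_bilin V W).1 w').
rewrite /tassoc !tlift_ten //; split=> [w'|t]; first exact: tlift_linear.
apply: linear_tlift_fun => u' v'.
exact: (linear_comp ((ten_bilin _ _).2 u') ((ten_bilin _ _).2 v')).
Qed.

Lemma tassoc_linear U V W : linear (@tassoc k U V W).
Proof.
have b1 (w' : W) : bilin (fun (u : U) (v : V) => ten u (ten v w')).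
  by apply: (bilin_comp (ten_bilin _ _)) => //; exact: ((ten_bilin V W).1 w').
apply: tlift_linear; split=> [w'|t]; first exact: tlift_linear.
apply: linear_tlift_fun => u' v'.
exact: (linear_comp ((ten_bilin _ _).2 u') ((ten_bilin _ _).2 v')).
Qed.

End BilinFacts.

Section EndCoaction.
Variables (k : fieldType) (H : hopfAlg k) (V : vectType k).
Variable rho : V -> tens V H.
Hypothesis rhoH : hcomodule rho.

Lemma conj_coact_linear (T : 'End(V)) : linear (conj_coact rho T).
Proof.
have lr := coact_linear rhoH.
refine (@linear_comp k V (tens V H) (tens V H) (tlift _) rho _ lr).
apply: tlift_linear; split=> [h|v].
  apply: (@linear_comp _ _ _ _ (tlift _) (fun v => rho (T v))).
    apply: tlift_linear; apply: (bilin_comp (ten_bilin V H)) => //.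
    exact: (algmul_bilin H).1.
  exact: linear_comp lr (lfun_linear _).
apply: linear_tlift_fun => w0 w1.
apply: (@linear_comp _ _ _ _ (ten w0)); first exact: (ten_bilin V H).2.
exact: (linear_comp ((algmul_bilin H).2 w1) (lfun_linear antipode)).
Qed.

Let rank1 i w : 'End(V) :=
  linfun (fun v => coord (vbasis {:V}) i v *: w).

Let rank1E i w v : rank1 i w v = coord (vbasis {:V}) i v *: w.
Proof.
have lin : linear (fun v => coord (vbasis {:V}) i v *: w).
  by move=> a x y; rewrite linearP scalerDl scalerA.
pose f : {linear V -> V} := HB.pack (fun v => coord (vbasis {:V}) i v *: w)
  (GRing.isLinear.Build k V V *:%R _ lin).
exact: (lfunE f).
Qed.

Let rank1_linear i : linear (rank1 i).
Proof.
move=> a x y; apply/lfunP => v; rewrite !lfunE /= lfunE /= !rank1E.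
by rewrite scalerDr !scalerA mulrC.
Qed.

Let ten_rank1_bilin i : bilin (fun w (h : H) => ten (rank1 i w) h).
Proof. exact: (bilin_comp (ten_bilin _ _) (rank1_linear i)). Qed.

Lemma end_coactP (T : 'End(V)) (t : tens 'End(V) H) :
  (forall v, tmap (fun S : 'End(V) => S v) id t = conj_coact rho T v)
  <-> t = end_coact rho T.
Proof.
have lev v : linear (tmap (fun S : 'End(V) => S v) (@id H)).
  by apply: tmap_linear => //; exact: ev_linear.
have lsum (W W' : lmodType k) (f : W -> W') I (r : seq I) G : linear f ->
    f (\sum_(i <- r) G i) = \sum_(i <- r) f (G i).
  move=> lf; pose f' : {linear W -> W'} :=
    HB.pack f (GRing.isLinear.Build k W W' *:%R f lf).
  exact: (linear_sum f').
split=> [tP|-> v].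
  rewrite /end_coact; under eq_bigr => i _ do rewrite -tP.
  apply: (@tens_linear_ext k _ _ _ id (fun t => \sum_i tlift _ (tmap _ id t))).
  - by [].
  - move=> a x y; rewrite scaler_sumr -big_split; apply: eq_bigr => i _.
    by rewrite lev tlift_linear //; exact: ten_rank1_bilin.
  move=> S h; under eq_bigr => i _.
    rewrite tmap_ten //; last exact: ev_linear.
    rewrite tlift_ten; last exact: ten_rank1_bilin.
    over.
  rewrite -(lsum _ _ (fun S => ten S h)); last exact: (ten_bilin _ _).1.
  congr ten; apply/lfunP => v; rewrite sum_lfunE {1}(coord_vbasis (memvf v)).
  by rewrite linear_sum; apply: eq_bigr => i _; rewrite linearZ rank1E.
have lc := conj_coact_linear T.
rewrite /end_coact lsum // [in RHS](coord_vbasis (memvf v)) lsum //.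
apply: eq_bigr => i _; rewrite linear_scale //.
apply: (@tens_linear_ext k _ _ _
  (fun t => tmap (fun S : 'End(V) => S v) id (tlift _ t)) (fun t => _ *: t)).
- exact: (linear_comp (lev v) (tlift_linear (ten_rank1_bilin i))).
- exact: linear_scaler.
move=> w h; rewrite tlift_ten; last exact: ten_rank1_bilin.
rewrite tmap_ten //; last exact: ev_linear.
rewrite rank1E; apply: (linear_scale (f := fun w => ten w h)).
exact: (ten_bilin _ _).1.
Qed.

End EndCoaction.

Section TensorAlgebraModule.
Variables (k : fieldType) (H : hopfAlg k) (L : lmodType k).
Variable act : H -> L -> L.
Hypothesis actH : hmodule act.

Let tcons_act_bilin (x : L) (F : H -> tensalg L) : linear F ->
  bilin (fun h1 h2 => tcons (act h1 x) (F h2)).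
Proof.
by move=> lF; apply: (bilin_comp (tcons_bilin L) _ lF); exact: (hact_linear actH).1.
Qed.

Let word_act_linear s : linear (fun h => word_act act h s).
Proof.
elim: s => [|x s IHs] /=.
  by move=> a g h; rewrite linearP scalerDl scalerA.
apply: (@linear_comp _ _ _ _ (tlift _) comul (tlift_linear _)).
  exact: tcons_act_bilin.
exact: lfun_linear.
Qed.

Let word_act_multilin h : multilin (word_act act h).
Proof.
move=> s1 s2 a x y; elim: s1 h => [|z s1 IHs] h /=.
  rewrite -tlift_linear_fun; apply: eq_tlift => h1 h2.
  by rewrite (hact_linear actH).2 (tcons_bilin L).1.
rewrite -tlift_linear_fun; apply: eq_tlift => h1 h2.
by rewrite IHs (tcons_bilin L).2.
Qed.

Let tensalg_act_bilin : bilin (tensalg_act act).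
Proof.
split=> [t|h]; last exact: lift_linear (word_act_multilin h).
move=> a g h; rewrite /tensalg_act /lift /fsum scaler_sumr -big_split.
by apply: eq_bigr => p _; rewrite word_act_linear scalerDr !scalerA mulrC.
Qed.

Let tensalg_act_tcons h x t : tensalg_act act h (tcons x t) =
  tlift (fun h1 h2 => tcons (act h1 x) (tensalg_act act h2 t)) (comul h).
Proof.
move: t; apply: pres_linear_ext => [||s].
- exact: linear_comp (tensalg_act_bilin.2 h) ((tcons_bilin L).2 x).
- apply: linear_tlift_fun => h1 h2.
  exact: linear_comp ((tcons_bilin L).2 _) (tensalg_act_bilin.2 h2).
rewrite -/(word s) tcons_word /tensalg_act lift_gen //=.
by apply: eq_tlift => h1 h2; rewrite lift_gen.
Qed.

Lemma tensalg_hmodule : hmodule (tensalg_act act).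
Proof.
split=> [|t|g h t]; first exact: tensalg_act_bilin.
  apply: (@pres_linear_ext _ _ _ _ (tensalg_act act 1) id) => // [|s].
    exact: tensalg_act_bilin.2.
  rewrite /tensalg_act lift_gen //= -/(word s).
  elim: s => [|x s IHs] /=; first by rewrite counit1 scale1r.
  rewrite comul1 tlift_ten; last exact: tcons_act_bilin.
  by rewrite IHs (hact1 actH) tcons_word.
move: t; apply: pres_linear_ext => [||s].
- exact: tensalg_act_bilin.2.
- exact: linear_comp (tensalg_act_bilin.2 g) (tensalg_act_bilin.2 h).
rewrite /tensalg_act !lift_gen //= -!/(tensalg_act _ _ _).
elim: s g h => [|x s IHs] g h /=.
  rewrite (linear_scale _ _ (tensalg_act_bilin.2 g)).
  by rewrite /tensalg_act lift_gen //= scalerA counitM mulrC.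
rewrite comulM linear_tlift; last first.
  by apply/tlift_linear/tcons_act_bilin.
rewrite linear_tlift; last exact: tensalg_act_bilin.2.
under [RHS]eq_tlift => h1 h2 do rewrite tensalg_act_tcons.
under [LHS]eq_tlift => g1 g2.
  rewrite linear_tlift; last exact/tlift_linear/tcons_act_bilin.
  under eq_tlift => h1 h2.
    rewrite tlift_ten; last exact: tcons_act_bilin.
    rewrite (hactM actH) IHs; over.
  over.
exact: tlift_exchange.
Qed.

End TensorAlgebraModule.

Section TensorAlgebraComodule.
Variables (k : fieldType) (H : hopfAlg k) (L : lmodType k).
Variable rho : L -> tens L H.
Hypothesis rhoH : hcomodule rho.
Local Notation TL := (tensalg L).
Local Notation rhoT := (tensalg_coact rho).

Let glue (p : tens L H) (q : tens TL H) : tens TL H :=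
  tlift (fun x0 x1 =>
    tlift (fun t0 t1 => ten (tcons x0 t0) (x1 * t1)) q) p.

Let glue_in1 x0 x1 :
  bilin (fun (t0 : TL) (t1 : H) => ten (tcons x0 t0) (x1 * t1)).
Proof.
apply: (bilin_comp (ten_bilin _ _)); first exact: (tcons_bilin L).2.
exact: (algmul_bilin H).2.
Qed.

Let glue_in2 t0 t1 :
  bilin (fun (x0 : L) (x1 : H) => ten (tcons x0 t0) (x1 * t1)).
Proof.
apply: (bilin_comp (ten_bilin _ _)); first exact: (tcons_bilin L).1.
exact: (algmul_bilin H).1.
Qed.

Let glue_out q : bilin (fun (x0 : L) (x1 : H) =>
  tlift (fun (t0 : TL) t1 => ten (tcons x0 t0) (x1 * t1)) q).
Proof. by apply: bilin_tlift_fun => t0 t1; exact: glue_in2. Qed.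

Let glue_bilin : bilin glue.
Proof.
split=> [q|p]; first exact/tlift_linear/glue_out.
by apply: linear_tlift_fun => x0 x1; exact/tlift_linear/glue_in1.
Qed.

Let glue_ten x0 x1 t0 t1 :
  glue (ten x0 x1) (ten t0 t1) = ten (tcons x0 t0) (x1 * t1).
Proof. by rewrite /glue tlift_ten // tlift_ten. Qed.

Let word_coact_cons x s : word_coact rho (x :: s) = glue (rho x) (word_coact rho s).
Proof. by []. Qed.

Let word_coact_multilin : multilin (word_coact rho).
Proof.
move=> s1 s2 a x y; elim: s1 => [|z s1 IHs]; rewrite ?cat0s ?cat_cons.
  by rewrite !word_coact_cons (coact_linear rhoH) glue_bilin.1.
by rewrite !word_coact_cons IHs glue_bilin.2.
Qed.

Let rhoT_linear : linear rhoT.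
Proof. exact: lift_linear word_coact_multilin. Qed.

Let rhoT_word s : rhoT (word s) = word_coact rho s.
Proof. exact: lift_gen word_coact_multilin. Qed.

Let rhoT_tcons x t : rhoT (tcons x t) = glue (rho x) (rhoT t).
Proof.
move: t; apply: pres_linear_ext => [||s].
- exact: linear_comp rhoT_linear ((tcons_bilin L).2 x).
- exact: linear_comp (glue_bilin.2 _) rhoT_linear.
by rewrite -/(word s) tcons_word !rhoT_word.
Qed.

Local Notation HH := (tens H H).

Let mulHH (p q : HH) : HH :=
  tlift (fun a b => tlift (fun c d => ten (a * c) (b * d)) q) p.

Let mulHH_in1 a b : bilin (fun c d : H => ten (a * c) (b * d)).
Proof. by apply: (bilin_comp (ten_bilin _ _)); exact: (algmul_bilin H).2. Qed.

Let mulHH_in2 c d : bilin (fun a b : H => ten (a * c) (b * d)).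
Proof. by apply: (bilin_comp (ten_bilin _ _)); exact: (algmul_bilin H).1. Qed.

Let mulHH_out q :
  bilin (fun a b : H => tlift (fun c d => ten (a * c) (b * d)) q).
Proof. by apply: bilin_tlift_fun => c d; exact: mulHH_in2. Qed.

Let mulHH_bilin : bilin mulHH.
Proof.
split=> [q|p]; first exact/tlift_linear/mulHH_out.
by apply: linear_tlift_fun => a b; exact/tlift_linear/mulHH_in1.
Qed.

Let glue3 (p : tens L HH) (q : tens TL HH) : tens TL HH :=
  tlift (fun x m => tlift (fun t n => ten (tcons x t) (mulHH m n)) q) p.

Let glue3_in1 x m : bilin (fun t n => ten (tcons x t : TL) (mulHH m n)).
Proof.
apply: (bilin_comp (ten_bilin _ _)); first exact: (tcons_bilin L).2.
exact: mulHH_bilin.2.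
Qed.

Let glue3_in2 (t : TL) n : bilin (fun x m => ten (tcons x t) (mulHH m n)).
Proof.
apply: (bilin_comp (ten_bilin _ _)); first exact: (tcons_bilin L).1.
exact: mulHH_bilin.1.
Qed.

Let glue3_out q : bilin (fun x m =>
  tlift (fun (t : TL) n => ten (tcons x t) (mulHH m n)) q).
Proof. by apply: bilin_tlift_fun => t n; exact: glue3_in2. Qed.

Let glue3_bilin : bilin glue3.
Proof.
split=> [q|p]; first exact/tlift_linear/glue3_out.
by apply: linear_tlift_fun => a b; exact/tlift_linear/glue3_in1.
Qed.

Let bilin_ext (A B C D W : lmodType k) (f g : tens A B -> tens C D -> W) :
  bilin f -> bilin g ->
  (forall a b c d, f (ten a b) (ten c d) = g (ten a b) (ten c d)) -> f =2 g.
Proof.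
move=> bf bg fg p q; move: p.
apply: (@tens_linear_ext k _ _ _ (f^~ q) (g^~ q)) => [||a b].
- exact: bf.1.
- exact: bg.1.
by move: q; apply: tens_linear_ext => [||c d]; [exact: bf.2|exact: bg.2|].
Qed.

Let copyr (V : lmodType k) : tens V H -> tens V HH := tmap id comul.

Let copyr_linear V : linear (@copyr V).
Proof. by apply: tmap_linear => //; exact: lfun_linear. Qed.

Let copyr_glue p q : copyr (glue p q) = glue3 (copyr p) (copyr q).
Proof.
move: p q; apply: bilin_ext => [||a b c d].
- exact: linear_bilin (@copyr_linear _) glue_bilin.
- exact: bilin_comp glue3_bilin (@copyr_linear _) (@copyr_linear _).
have lc : linear (@comul k H) by exact: lfun_linear.
rewrite glue_ten /copyr !tmap_ten // /glue3 tlift_ten; last exact: glue3_out.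
by rewrite tlift_ten; [rewrite comulM|exact: glue3_in1].
Qed.

Let copyl (V : lmodType k) (r : V -> tens V H) (t : tens V H) : tens V HH :=
  tassoc (tmap r id t).

Let copyl_linear V r : linear r -> linear (@copyl V r).
Proof.
move=> lr; apply: linear_comp (@tassoc_linear k _ _ _) _.
exact: tmap_linear.
Qed.

Let copyl_glue p q : copyl rhoT (glue p q) = glue3 (copyl rho p) (copyl rhoT q).
Proof.
have lr := coact_linear rhoH.
move: p q; apply: bilin_ext => [||a b c d].
- exact: linear_bilin (copyl_linear rhoT_linear) glue_bilin.
- exact: bilin_comp glue3_bilin (copyl_linear lr) (copyl_linear rhoT_linear).
rewrite glue_ten /copyl !tmap_ten // rhoT_tcons.
move: (rho a) (rhoT c); apply: bilin_ext => [||x0 x1 t0 t1].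
- apply: (@linear_bilin _ _ _ _ _ (fun w => tassoc (ten w (b * d)))) glue_bilin.
  exact: linear_comp (@tassoc_linear k _ _ _) ((ten_bilin _ _).1 _).
- by apply: (bilin_comp glue3_bilin);
    exact: linear_comp (@tassoc_linear k _ _ _) ((ten_bilin _ _).1 _).
rewrite glue_ten !tassoc_ten /glue3 tlift_ten; last exact: glue3_out.
rewrite tlift_ten; last exact: glue3_in1.
by rewrite /mulHH tlift_ten // tlift_ten.
Qed.

Let eps (V : lmodType k) : tens V H -> V :=
  tlift (fun v h => (counit h : k) *: v).

Let eps_in (V : lmodType k) : bilin (fun (v : V) (h : H) => (counit h : k) *: v).
Proof.
split=> [h a x y|v a x y]; last by rewrite linearP scalerDl scalerA.
by rewrite scalerDr !scalerA mulrC.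
Qed.

Let eps_glue p q : eps (glue p q) = tcons (eps p) (eps q).
Proof.
have le (V : lmodType k) : linear (@eps V) by exact/tlift_linear/eps_in.
move: p q; apply: bilin_ext => [||a b c d].
- exact: linear_bilin (le _) glue_bilin.
- exact: bilin_comp (tcons_bilin L) (le _) (le _).
have lin x : linear (@tcons k L x) := (tcons_bilin L).2 x.
have lin' t : linear (fun x => @tcons k L x t) := (tcons_bilin L).1 t.
rewrite glue_ten /eps !(tlift_ten _ _ (@eps_in _)).
rewrite (linear_scale _ _ (lin _)) (linear_scale _ _ (lin' _)).
by rewrite scalerA counitM mulrC.
Qed.

Lemma tensalg_hcomodule : hcomodule rhoT.
Proof.
split=> [|t|t]; first exact: rhoT_linear.
  move: t; apply: (@pres_linear_ext _ _ _ _
    (fun t => copyl rhoT (rhoT t)) (fun t => copyr (rhoT t))) => [||s].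
  - exact: linear_comp (copyl_linear rhoT_linear) rhoT_linear.
  - exact: linear_comp (@copyr_linear _) rhoT_linear.
  rewrite -/(word s); elim: s => [|x s IHs].
    have lc : linear (@comul k H) by exact: lfun_linear.
    rewrite rhoT_word /copyl /copyr /= !tmap_ten // rhoT_word /=.
    by rewrite tassoc_ten comul1.
  rewrite -tcons_word rhoT_tcons copyl_glue copyr_glue IHs.
  by congr glue3; exact: coactA.
move: t; apply: (@pres_linear_ext _ _ _ _ (fun t => eps (rhoT t)) id) => // [|s].
  exact: linear_comp (tlift_linear (@eps_in _)) rhoT_linear.
rewrite -/(word s); elim: s => [|x s IHs].
  rewrite rhoT_word /eps [word_coact _ _]/= tlift_ten; last exact: eps_in.
  by rewrite counit1 scale1r.
rewrite -tcons_word rhoT_tcons eps_glue IHs; congr tcons.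
exact: coact_counit.
Qed.

End TensorAlgebraComodule.

(* Main.v *)
From HB Require Import structures.
Require Import Defs.
From mathcomp Require Import all_boot all_order all_algebra.
From mathcomp Require Import boolp.

Set Implicit Arguments.
Unset Strict Implicit.
Unset Printing Implicit Defensive.

Import GRing.Theory.
Local Open Scope ring_scope.

(** Let A = alg<ad L> and let tau(a) be the trace of left multiplication by a
on A.  The proof rests on a trace description of the nilradical:
    x lies in n(L)  iff  tau(ad x . b) = 0 for all b in A,
proved as [mem_nilradicalE] by classical arguments.  If x lies in n(L), the
operator ad x . b moves each term of the lower central series of n(L) into the
next one, so it is nilpotent and its trace vanishes.  Conversely, if
tau(f b) = 0 for all b, then all powers of left multiplication by f have trace
0.  A suitable polynomial in a non-nilpotent operator T, without constant term,
is a nonzero idempotent whose trace is its rank; as dim A < char k if char k > 0,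
this rank is nonzero in k, so f must be nilpotent ([power_traces0_nilpotent]).
Thus the radical of the trace form of A is an ideal of nilpotent elements, and a
Nakayama argument ([radical_bracket_fixed_ideal0]) shows that the x with ad x
in this radical form a nilpotent ideal of L.

The Hopf algebra enters through one identity, valid for every bilinear
H-equivariant f : U x V -> W ([equivariant_adjoint]):
    f(h u, v) = h_1 f(u, S(h_2) v),
which says that the map U -> Hom(V, W) is H-linear.  It is used three times.
 - For the action of TL on L through ad, it shows that the kernel of TL -> A is
   H-stable, because a tensor is in that kernel when it acts by 0.  Hence A is
   a finite-dimensional quotient H-module of TL, and it is tracial.
 - For the action of TL on A by left multiplication, it shows that h acts on the
   operator of t by turning it into the operator of h t, so traciality of A
   makes the trace of this operator an H-invariant functional on TL.
 - Then (x, t) |-> tau(ad x . t) is an equivariant pairing L x TL -> k, and the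
   identity shows that its left radical, which is n(L), is H-stable.
The comodule case runs along the same lines with
    f(u_0, v) (x) u_1 = f(u, v_0)_0 (x) f(u, v_0)_1 S(v_1)
([coequivariant_adjoint]).  There the last step gives that the coaction of x is
killed by all the functionals tau(ad(-) . t) (x) id, and [supported_kernels]
turns this into membership in n(L) (x) H. *)

(** * Calculus in tensor products *)

Section LinearMaps.
Variable k : fieldType.
Implicit Types U V W X Y Z : lmodType k.

Lemma linear_map0 U V (f : U -> V) : linear f -> f 0 = 0.
Proof.
by move=> lf; rewrite -[X in f X](scale0r 0) linear_scale // scale0r.
Qed.

Lemma linear_mapB U V (f : U -> V) u v : linear f -> f (u - v) = f u - f v.
Proof. by move=> lf; rewrite addrC -scaleN1r lf scaleN1r addrC. Qed.

Lemma linfun_linearE (U V : vectType k) (f : U -> V) u :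
  linear f -> linfun f u = f u.
Proof.
move=> lf; pose f' : {linear U -> V} :=
  HB.pack f (GRing.isLinear.Build k U V *:%R f lf).
exact: (lfunE f').
Qed.

Lemma bilin_tens_ext U V X Y W (f g : tens U V -> tens X Y -> W) :
  bilin f -> bilin g ->
  (forall u v x y, f (ten u v) (ten x y) = g (ten u v) (ten x y)) -> f =2 g.
Proof.
move=> bf bg fg t s; move: t.
apply: (@tens_linear_ext k _ _ _ (f^~ s) (g^~ s)) => [||u v].
- exact: bf.1.
- exact: bg.1.
by move: s; apply: tens_linear_ext => [||x y]; [exact: bf.2|exact: bg.2|].
Qed.

Lemma scale_bilin V : bilin (fun (c : k^o) (v : V) => (c : k) *: v).
Proof.
split=> [v a b c|c a u v]; first by rewrite scalerDl scalerA.
by rewrite scalerDr !scalerA mulrC.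
Qed.

Lemma bilin_swap U V W (f : U -> V -> W) : bilin f -> bilin (fun v u => f u v).
Proof. by case. Qed.

Lemma tlift_eq0 U V W (f : U -> V -> W) t :
  (forall u v, f u v = 0) -> tlift f t = 0.
Proof.
move=> f0; rewrite /tlift /Defs.lift /fsum.
by rewrite big1 // => p _; rewrite f0 scaler0.
Qed.

Lemma tlift_tmap U V X Y W (f : X -> Y -> W) (g : U -> X) (h : V -> Y) t :
  bilin f -> linear g -> linear h ->
  tlift f (tmap g h t) = tlift (fun u v => f (g u) (h v)) t.
Proof.
move=> bf lg lh; rewrite linear_tlift; last exact: tlift_linear.
by apply: eq_tlift => u v; rewrite tlift_ten.
Qed.

Lemma eq_tmap U V X Y (f f' : U -> X) (g g' : V -> Y) t :
  f =1 f' -> g =1 g' -> tmap f g t = tmap f' g' t.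
Proof. by move=> ff gg; apply: eq_tlift => u v; rewrite ff gg. Qed.

Lemma tmap_id U V (t : tens U V) : tmap id id t = t.
Proof.
move: t; apply: tens_linear_ext => [||u v] //; first exact: tmap_linear.
by rewrite tmap_ten.
Qed.

Lemma tmap_comp U V U' V' U2 V2 (f : U' -> U2) (g : V' -> V2)
    (f' : U -> U') (g' : V -> V') t :
  linear f -> linear g -> linear f' -> linear g' ->
  tmap f g (tmap f' g' t) = tmap (fun u => f (f' u)) (fun v => g (g' v)) t.
Proof.
move=> lf lg lf' lg'; rewrite {1}/tmap tlift_tmap //.
exact: (bilin_comp (ten_bilin _ _)).
Qed.

Lemma tassoc_tmap U V W U' V' W' (f : U -> U') (g : V -> V') (h : W -> W') t :
  linear f -> linear g -> linear h ->
  tassoc (tmap (tmap f g) h t) = tmap f (tmap g h) (tassoc t).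
Proof.
move=> lf lg lh; have lfg := tmap_linear lf lg; have lgh := tmap_linear lg lh.
move: t; apply: tens_linear_ext => [||q w].
- exact: linear_comp (@tassoc_linear k _ _ _) (tmap_linear lfg lh).
- exact: linear_comp (tmap_linear lf lgh) (@tassoc_linear k _ _ _).
move: q; apply: (@tens_linear_ext k _ _ _
  (fun q => tassoc (tmap (tmap f g) h (ten q w)))
  (fun q => tmap f (tmap g h) (tassoc (ten q w)))) => [||u v].
- apply: linear_comp (@tassoc_linear k _ _ _) _.
  exact: linear_comp (tmap_linear lfg lh) ((ten_bilin _ _).1 _).
- apply: linear_comp (tmap_linear lf lgh) _.
  exact: linear_comp (@tassoc_linear k _ _ _) ((ten_bilin _ _).1 _).
by rewrite !tassoc_ten !tmap_ten // tassoc_ten.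
Qed.

Definition trilin U V W Z (F : U -> V -> W -> Z) : Prop :=
  (forall w, bilin (fun u v => F u v w)) /\ (forall u v, linear (F u v)).

Lemma trilin_bilin U V W Z (F : U -> V -> W -> Z) u : trilin F -> bilin (F u).
Proof. by move=> [b l]; split=> [w|v]; [exact: (b w).2|exact: l]. Qed.

Lemma tlift_tassoc U V W Z (F : U -> V -> W -> Z) t : trilin F ->
  tlift (fun u s => tlift (F u) s) (tassoc t) =
  tlift (fun s w => tlift (fun u v => F u v w) s) t.
Proof.
move=> tF; have bout : bilin (fun u s => tlift (F u) s).
  split=> [s|u]; last exact/tlift_linear/trilin_bilin.
  by apply: linear_tlift_fun => v w; exact: (tF.1 w).1.
have bout' : bilin (fun s w => tlift (fun u v => F u v w) s).
  split=> [w|s]; first exact: (tlift_linear (tF.1 w)).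
  by apply: linear_tlift_fun => u v; exact: tF.2.
move: t; apply: tens_linear_ext => [||s w].
- exact: linear_comp (tlift_linear bout) (@tassoc_linear k _ _ _).
- exact: tlift_linear.
rewrite tlift_ten //; move: s; apply: (@tens_linear_ext k _ _ _
  (fun s => tlift _ (tassoc (ten s w))) (fun s => tlift _ s)) => [||u v].
- apply: linear_comp (tlift_linear bout) _.
  exact: linear_comp (@tassoc_linear k _ _ _) ((ten_bilin _ _).1 w).
- exact: (tlift_linear (tF.1 w)).
by rewrite tassoc_ten tlift_ten // tlift_ten ?tlift_ten //;
  [exact: tF.1|exact: trilin_bilin].
Qed.

(** Coassociativity in the only form in which it is used below: under a
trilinear F one may replace v_00 (x) v_01 (x) v_1 by v_0 (x) v_11 (x) v_12.
With r = d this is coassociativity of a coalgebra, and with r a coaction it is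
the axiom of a comodule. *)
Lemma tlift_coassoc (C V W : lmodType k) (r : V -> tens V C)
    (d : C -> tens C C) (F : V -> C -> C -> W) v :
  linear r -> linear d -> tassoc (tmap r id (r v)) = tmap id d (r v) ->
  trilin F ->
  tlift (fun v' c => tlift (fun v0 v1 => F v0 v1 c) (r v')) (r v) =
  tlift (fun v0 c => tlift (F v0) (d c)) (r v).
Proof.
move=> lr ld ra tF; have /= := congr1 (tlift (fun u s => tlift (F u) s)) ra.
rewrite tlift_tassoc // tlift_tmap //; last first.
  split=> [c|s]; first exact: (tlift_linear (tF.1 c)).
  by apply: linear_tlift_fun => u v'; exact: tF.2.
rewrite tlift_tmap //; split=> [s|u]; last exact/tlift_linear/trilin_bilin.
by apply: linear_tlift_fun => v' w; exact: (tF.1 w).1.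
Qed.

End LinearMaps.

(** * Tensors supported on a subspace *)
Section TensorSupport.
Variables (k : fieldType) (E : vectType k) (X : lmodType k).
Implicit Types (U W : {vspace E}) (t : tens E X) (f : E -> k^o).

Definition supported t U : Prop :=
  exists s : tens (subvs_of U) X, t = tmap vsval id s.

Definition contract f : tens E X -> X := tlift (fun e x => (f e : k) *: x).

Lemma contractE f t : linear f ->
  contract f t = tlift (fun (c : k^o) x => (c : k) *: x) (tmap f id t).
Proof. by move=> lf; rewrite tlift_tmap //; exact: scale_bilin. Qed.

Lemma vsval_linear U : linear (@vsval _ _ U).
Proof. exact: lfun_linear. Qed.

Lemma supported_linear t U W (g : E -> E) : linear g ->
  (forall e, e \in U -> g e \in W) -> supported t U ->
  supported (tmap g id t) W.
Proof.
move=> lg gUW [s ->].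
pose g' (u : subvs_of U) := vsproj W (g (vsval u)).
have lg' : linear g'.
  apply: linear_comp; first exact: lfun_linear.
  exact: linear_comp lg (@vsval_linear U).
exists (tmap g' id s); rewrite !tmap_comp //; try exact: vsval_linear.
by apply: eq_tmap => // u; rewrite /g' vsprojK // gUW // subvsP.
Qed.

(** If f does not vanish on U, choose e in U with f e = 1 after scaling.  The
projection g along e onto the kernel of f fixes t, since it changes t by
e (x) (f (x) id) t = 0; so t already lives on the kernel of f in U. *)
Lemma supported_ker t U f : linear f -> contract f t = 0 -> supported t U ->
  exists W, [/\ (W <= U)%VS, supported t W & forall e, e \in W -> f e = 0].
Proof.
move=> lf ft0 st.
have [f0|] := EM (forall e, e \in U -> f e = 0); first by exists U.
move=> /existsNP[e /not_implyP[eU /eqP fe]].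
pose g x : E := x - (f x / f e) *: e.
have lg : linear g.
  move=> a x y; rewrite /g lf scalerBr scalerA mulrDl scalerDl -scalerAl.
  by rewrite opprD addrACA.
have gt : tmap g id t = t.
  have h s : tmap g id s = s - ten e ((f e)^-1 *: contract f s).
    move: s; apply: tens_linear_ext => [||u x].
    - exact: tmap_linear.
    - move=> a s s'.
      have lc : linear (contract f).
        by apply: tlift_linear; apply: (bilin_comp (@scale_bilin k X)).
      rewrite lc scalerDr scalerA (mulrC _ a) -scalerA (ten_bilin _ _).2.
      by rewrite scalerBr opprD addrACA.
    rewrite tmap_ten // /contract tlift_ten; last first.
      by apply: (bilin_comp (@scale_bilin k X)).
    rewrite (linear_mapB _ _ ((ten_bilin _ _).1 x)) scalerA.
    rewrite (linear_scale _ _ ((ten_bilin _ _).1 x)).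
    by rewrite (linear_scale _ _ ((ten_bilin _ _).2 e)) mulrC.
  by rewrite h ft0 scaler0 (linear_map0 ((ten_bilin _ _).2 e)) subr0.
exists (U :&: lker (linfun f))%VS; split; first exact: capvSl.
  rewrite -gt; apply: supported_linear st => // u uU.
  rewrite memv_cap memv_ker linfun_linearE // memvB ?memvZ //=.
  by rewrite linear_mapB // linear_scale // -[_ *: _]/(_ * _) divfK ?subrr.
by move=> u; rewrite memv_cap memv_ker linfun_linearE // => /andP[_ /eqP].
Qed.

(** Over a field, the intersection of the kernels of f (x) id, over any family
of functionals f on a finite-dimensional E, is the intersection of the kernels
of the f, tensored with X.  A support of t of least dimension cannot be shrunk
by [supported_ker], so every f of the family vanishes on it. *)
Lemma supported_kernels t (P : (E -> k^o) -> Prop) W :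
  (forall f, P f -> linear f /\ contract f t = 0) ->
  (forall e, (forall f, P f -> f e = 0) -> e \in W) -> supported t W.
Proof.
move=> Pt WP.
have ex : exists n, `[< exists2 U, supported t U & \dim U = n >].
  exists (\dim {:E}); apply/asboolP; exists fullv => //.
  exists (tmap (vsproj fullv) id t).
  rewrite tmap_comp //; try exact: lfun_linear.
  rewrite -{1}[t]tmap_id.
  by apply: eq_tmap => // e; rewrite vsprojK // memvf.
case: (ex_minnP ex) => n /asboolP[U sU dU] minU.
have UW : (U <= W)%VS.
  apply/subvP => e eU; apply: WP => f /Pt[lf ft0].
  have [V [VU sV f0]] := supported_ker lf ft0 sU.
  apply: f0; suff -> : V = U by [].
  apply/eqP; rewrite eqEdim VU dU; apply: minU.
  by apply/asboolP; exists V.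
rewrite -[t]tmap_id; apply: supported_linear sU => // e; exact: (subvP UW).
Qed.

End TensorSupport.

(** * Actions of the tensor algebra *)
Section TensorAlgebraAction.
Variables (k : fieldType) (L Z : lmodType k) (gam : L -> Z -> Z).
Hypothesis gam_bilin : bilin gam.

(** The action of TL on Z that extends gam : L x Z -> Z multiplicatively. *)
Definition tact (t : tensalg L) (z : Z) : Z :=
  Defs.lift (fun s => foldr gam z s) t.

(** Induction on words; the predicate is kept general so that an induction
hypothesis can quantify over elements of a Hopf algebra and over vectors. *)
Lemma tensalg_ind (P : tensalg L -> Prop) :
  (forall a t u, P t -> P u -> P (a *: t + u)) -> P (word [::]) ->
  (forall x t, P t -> P (tcons x t)) -> forall t, P t.
Proof.
move=> Plin P1 Pcons t.
have P0 : P 0 by rewrite -(addNr (word [::])) -scaleN1r; exact: Plin.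
rewrite (pres_repr t); elim: (repr t : seq _) => [|[a s] r IHr].
  by rewrite big_nil.
rewrite big_cons; apply: Plin => //=; rewrite -/(word s).
by elim: s => [|x s IHs] //; rewrite -tcons_word; exact: Pcons.
Qed.

Let fold_multilin z : multilin (fun s => foldr gam z s).
Proof.
move=> s1 s2 a x y; elim: s1 => [|w s1 IHs] /=; first exact: gam_bilin.1.
by rewrite IHs gam_bilin.2.
Qed.

Lemma tact_word s z : tact (word s) z = foldr gam z s.
Proof. exact: lift_gen (fold_multilin z). Qed.

Lemma tact_bilin : bilin tact.
Proof.
split=> [z|t]; first exact: lift_linear (fold_multilin z).
move=> a z z'; rewrite /tact /Defs.lift /fsum scaler_sumr -big_split.
apply: eq_bigr => p _ /=; rewrite scalerA mulrC -scalerA -scalerDr.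
congr (_ *: _).
by elim: p.2 => //= x s ->; rewrite gam_bilin.2.
Qed.

Lemma tact_tcons x t z : tact (tcons x t) z = gam x (tact t z).
Proof.
move: t; apply: pres_linear_ext => [||s].
- exact: linear_comp (tact_bilin.1 z) ((tcons_bilin L).2 x).
- exact: linear_comp (gam_bilin.2 x) (tact_bilin.1 z).
by rewrite -/(word s) tcons_word !tact_word.
Qed.

End TensorAlgebraAction.

Section ActionTrace.
Variables (k : fieldType) (L : lmodType k) (V : vectType k) (bet : L -> V -> V).
Hypothesis bet_bilin : bilin bet.

Definition tact_trace (t : tensalg L) : k^o := endtr (linfun (tact bet t)).

Lemma endtr_linear : linear (@endtr k V).
Proof. by move=> a f g; rewrite /endtr passmx.mxof_linear linearP. Qed.

Lemma tact_lfun_linear : linear (fun t => linfun (tact bet t)).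
Proof.
have bt := tact_bilin bet_bilin; move=> a t u; apply/lfunP => v.
rewrite add_lfunE scale_lfunE !linfun_linearE; try exact: bt.2.
exact: bt.1.
Qed.

Lemma tact_trace_linear : linear tact_trace.
Proof. exact: linear_comp endtr_linear tact_lfun_linear. Qed.

End ActionTrace.

(** * Modules over a Hopf algebra *)
Section ModuleCase.
Variables (k : fieldType) (H : hopfAlg k).

Definition equivariant (U V W : lmodType k) (actU : H -> U -> U)
    (actV : H -> V -> V) (actW : H -> W -> W) (f : U -> V -> W) : Prop :=
  forall h u v, actW h (f u v) =
    tlift (fun h1 h2 => f (actU h1 u) (actV h2 v)) (comul h).

Lemma equivariant_of_morph (U V W : lmodType k) (actU : H -> U -> U)
    (actV : H -> V -> V) (actW : H -> W -> W) (f : U -> V -> W) :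
  hmodule actU -> hmodule actV -> bilin f ->
  hmod_morph (tens_act actU actV) actW (tlift f) ->
  equivariant actU actV actW f.
Proof.
move=> hU hV bf [lf mf] h u v.
rewrite -(tlift_ten u v bf) -mf /tens_act tlift_ten.
  by rewrite (linear_tlift _ _ lf); apply: eq_tlift => h1 h2; rewrite tlift_ten.
apply: bilin_tlift_fun => h1 h2.
have [bU bV] := (hact_linear hU, hact_linear hV).
exact: bilin_comp (ten_bilin _ _) (bU.2 h1) (bV.2 h2).
Qed.

(** The right-hand side is f(h_1 u, h_2 S(h_3) v) by equivariance, and the
antipode axiom collapses h_2 S(h_3). *)
Lemma equivariant_adjoint (U V W : lmodType k) (actU : H -> U -> U)
    (actV : H -> V -> V) (actW : H -> W -> W) (f : U -> V -> W) h u v :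
  hmodule actU -> hmodule actV -> bilin f -> equivariant actU actV actW f ->
  f (actU h u) v =
  tlift (fun h1 h2 => actW h1 (f u (actV (antipode h2) v))) (comul h).
Proof.
move=> hU hV bf ef; have bU := hact_linear hU; have bV := hact_linear hV.
have lS : linear (@antipode k H) by exact: lfun_linear.
under eq_tlift => h1 h2 do rewrite ef.
pose F a b c := f (actU a u) (actV b (actV (antipode c) v)).
have tF : trilin F.
  split=> [c|a b]; first exact: bilin_comp bf (bU.1 u) (bV.1 _).
  apply: linear_comp (bf.2 _) _; apply: linear_comp (bV.2 b) _.
  exact: linear_comp (bV.1 v) lS.
rewrite (tlift_coassoc _ _ (comulA h) tF); try exact: lfun_linear.
have inner a b : tlift (F a) (comul b) = f (actU ((counit b : k) *: a) u) v.
  transitivity (f (actU a u)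
    (actV (tlift (fun b1 b2 => b1 * antipode b2) (comul b)) v)).
    have l1 : linear (fun b => f (actU a u) (actV b v)).
      exact: linear_comp (bf.2 _) (bV.1 v).
    rewrite (linear_tlift _ _ l1).
    by apply: eq_tlift => b1 b2; rewrite /F (hactM hV).
  rewrite antipoder (linear_scale _ _ (bV.1 v)) (hact1 hV).
  rewrite (linear_scale _ _ (bU.1 u)) (linear_scale _ _ (bf.1 v)).
  by rewrite (linear_scale _ _ (bf.2 _)).
rewrite (eq_tlift _ inner) -{1}[h]counit_comulr.
by rewrite (linear_tlift _ _ (linear_comp (bf.1 v) (bU.1 u))).
Qed.

(** The action on V is computed on arbitrary preimages; all axioms then follow
from those of M, since p is onto. *)
Lemma quotient_hmodule (M V : lmodType k) (actM : H -> M -> M) (p : M -> V) :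
  hmodule actM -> linear p -> (forall v, exists m, p m = v) ->
  (forall h m, p m = 0 -> p (actM h m) = 0) ->
  exists2 actV : H -> V -> V, hmodule actV & hmod_morph actM actV p.
Proof.
move=> hM lp sp kp; have [s ps] := choice sp; have bM := hact_linear hM.
pose actV h v := p (actM h (s v)).
have actVE h m : actV h (p m) = p (actM h m).
  apply/eqP; rewrite -subr_eq0 -(linear_mapB _ _ lp) -(linear_mapB _ _ (bM.2 h)).
  by apply/eqP; apply: kp; rewrite (linear_mapB _ _ lp) ps subrr.
exists actV; last by split=> // h m; rewrite actVE.
split=> [|v|g h v].
- split=> [v|h].
    exact: linear_comp lp (bM.1 (s v)).
  move=> a u v; rewrite -[u]ps -[v]ps -lp !actVE.
  by rewrite (bM.2 h) lp.
- by rewrite -[v]ps actVE (hact1 hM).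
- by rewrite -[v]ps !actVE (hactM hM).
Qed.

Section Action.
Variables (L : lmodType k) (act : H -> L -> L).
Hypothesis hL : hmodule act.
Local Notation actT := (tensalg_act act).

Let bT := hact_linear (tensalg_hmodule hL).
Let bL := hact_linear hL.

Let word_act_multilin h : multilin (word_act act h).
Proof.
move=> s1 s2 a x y; elim: s1 h => [|z s1 IHs] h /=;
  rewrite -tlift_linear_fun; apply: eq_tlift => h1 h2.
  by rewrite bL.2 (tcons_bilin L).1.
by rewrite IHs (tcons_bilin L).2.
Qed.

Let actT_word h s : actT h (word s) = word_act act h s.
Proof. exact: lift_gen (word_act_multilin h). Qed.

Lemma tcons_equivariant : equivariant act actT actT (@tcons k L).
Proof.
move=> h x t; move: t; apply: pres_linear_ext => [||s].
- exact: linear_comp (bT.2 h) ((tcons_bilin L).2 x).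
- apply: linear_tlift_fun => h1 h2.
  exact: linear_comp ((tcons_bilin L).2 _) (bT.2 h2).
rewrite -/(word s) tcons_word actT_word.
by apply: eq_tlift => h1 h2; rewrite actT_word.
Qed.

(** By induction on words: for a word starting with x the induction hypothesis
gives h_1 x acting on (h_2 t)(h_3 z), where the comultiplication was applied to
the second factor; coassociativity moves it to the first. *)
Lemma tact_equivariant (Z : lmodType k) (actZ : H -> Z -> Z)
    (gam : L -> Z -> Z) :
  hmodule actZ -> bilin gam -> equivariant act actZ actZ gam ->
  equivariant actT actZ actZ (tact gam).
Proof.
move=> hZ bg eg h t z; move: t h; have bZ := hact_linear hZ.
have bt := tact_bilin bg.
have lc : linear (@comul k H) by exact: lfun_linear.
apply: tensalg_ind => [a t u IHt IHu h||x t IHt h].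
- rewrite bt.1 (bZ.2 h) IHt IHu -tlift_linear_fun.
  by apply: eq_tlift => h1 h2; rewrite (bT.2 h1) bt.1.
- move=> h; rewrite tact_word //= -{1}[h]counit_comull.
  rewrite (linear_tlift _ _ (bZ.1 z)); apply: eq_tlift => h1 h2.
  rewrite actT_word /= (linear_scale _ _ (bZ.1 z)).
  by rewrite (linear_scale _ _ (bt.1 _)) tact_word.
rewrite tact_tcons // eg.
pose F a b c := tact gam (tcons (act a x) (actT b t)) (actZ c z).
have tF : trilin F.
  split=> [c|a b]; last exact: linear_comp (bt.2 _) (bZ.1 z).
  apply: linear_bilin (bt.1 _) _.
  exact: bilin_comp (tcons_bilin L) (bL.1 x) (bT.1 t).
transitivity (tlift (fun a c => tlift (F a) (comul c)) (comul h)).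
  apply: eq_tlift => h1 h2; rewrite IHt linear_tlift; last exact: bg.2.
  by apply: eq_tlift => a b; rewrite /F tact_tcons.
rewrite -(tlift_coassoc lc lc (comulA h) tF).
apply: eq_tlift => h1 h2; rewrite tcons_equivariant.
by rewrite (linear_tlift _ _ (bt.1 _)).
Qed.

(** The adjoint identity says that h acts on the endomorphism t of V by
turning it into the endomorphism h t. *)
Lemma hmod_tracial_trace_invariant (V : vectType k) (actV : H -> V -> V)
    (bet : L -> V -> V) h t :
  hmodule actV -> bilin bet -> equivariant act actV actV bet ->
  hmod_tracial actV ->
  tact_trace bet (actT h t) =
  triv_act h (tact_trace bet t).
Proof.
move=> hV bb eb [_ trV]; rewrite -trV; congr endtr.
have bt := tact_bilin bb; apply/lfunP => v.
rewrite linfun_linearE; last exact: bt.2.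
rewrite (equivariant_adjoint _ _ _ (tensalg_hmodule hL) hV bt
  (tact_equivariant hV bb eb)).
rewrite /end_act (linear_tlift _ _ (@ev_linear k V V v)).
have bV := hact_linear hV.
apply: eq_tlift => h1 h2; rewrite [RHS]linfun_linearE.
  by rewrite linfun_linearE //; exact: bt.2.
apply: linear_comp (bV.2 h1) _; apply: linear_comp _ (bV.2 _).
exact: lfun_linear.
Qed.

End Action.

(** V is the quotient of TL that is generated by v0, and Z is an H-module on
which TL acts with the same kernel: ev embeds V into the endomorphisms of Z.
For the adjoint algebra, V = A, v0 = 1 and Z = L. *)
Lemma hmod_trace_radical_invariant (L : lmodType k) (act : H -> L -> L)
    (Z : lmodType k) (actZ : H -> Z -> Z) (gam : L -> Z -> Z)
    (V : vectType k) (bet : L -> V -> V) (v0 : V) (ev : V -> Z -> Z) :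
  hmodule act -> hmod_cohereditarily_tracial (tensalg_act act) ->
  hmodule actZ -> bilin gam -> equivariant act actZ actZ gam ->
  bilin bet -> (forall v, exists t, tact bet t v0 = v) ->
  bilin ev -> (forall t z, ev (tact bet t v0) z = tact gam t z) ->
  (forall v, (forall z, ev v z = 0) -> v = 0) ->
  forall h x,
  (forall t, tact_trace bet (tcons x t) = 0) ->
  forall t, tact_trace bet (tcons (act h x) t) = 0.
Proof.
move=> hL trT hZ bg eg bb surj bev evE ev0 h x x0 t.
have hT := tensalg_hmodule hL; have bt := tact_bilin bb.
have bV0 : linear (fun t => tact bet t v0) := bt.1 v0.
have bZ := hact_linear hZ.
have kp h' t' : tact bet t' v0 = 0 -> tact bet (tensalg_act act h' t') v0 = 0.
  move=> t'0; apply: ev0 => z; rewrite evE.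
  rewrite (equivariant_adjoint _ _ _ hT hZ (tact_bilin bg)
    (tact_equivariant hL hZ bg eg)).
  apply: tlift_eq0 => a b.
  by rewrite -evE t'0 (linear_map0 (bev.1 _)) (linear_map0 (bZ.2 a)).
have [actV hV mp] := quotient_hmodule hT bV0 surj kp.
have eb : equivariant act actV actV bet.
  move=> h' y v; have [u <-] := surj v.
  rewrite -tact_tcons // -mp.2 (tcons_equivariant hL) (linear_tlift _ _ bV0).
  by apply: eq_tlift => a b; rewrite tact_tcons // mp.2.
have trV := trT _ _ hV _ mp surj.
pose g y u : k^o := tact_trace bet (tcons y u).
have ltr := tact_trace_linear bb.
have bgg : bilin g := linear_bilin ltr (tcons_bilin L).
have egg : equivariant act (tensalg_act act) (@triv_act k H) g.
  move=> h' y u; rewrite /g -(hmod_tracial_trace_invariant hL _ _ hV bb eb trV).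
  by rewrite (tcons_equivariant hL) (linear_tlift _ _ ltr).
rewrite -/(g _ _) (equivariant_adjoint _ _ _ hL hT bgg egg).
by apply: tlift_eq0 => a b; rewrite /g x0 /triv_act mulr0.
Qed.

End ModuleCase.

(** * Comodules over a Hopf algebra *)
Section ComoduleCase.
Variables (k : fieldType) (H : hopfAlg k).

(** The map u (x) g, v (x) h |-> f(u, v) (x) g h, through which a diagonal
coaction factors. *)
Definition diag (U V W : lmodType k) (f : U -> V -> W) (p : tens U H)
    (q : tens V H) : tens W H :=
  tlift (fun u0 u1 => tlift (fun v0 v1 => ten (f u0 v0) (u1 * v1)) q) p.

Definition coequivariant (U V W : lmodType k) (rhoU : U -> tens U H)
    (rhoV : V -> tens V H) (rhoW : W -> tens W H) (f : U -> V -> W) : Prop :=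
  forall u v, rhoW (f u v) = diag f (rhoU u) (rhoV v).

Section Diagonal.
Variables (U V W : lmodType k) (f : U -> V -> W).
Hypothesis bf : bilin f.

Let in1 (u0 : U) (u1 : H) : bilin (fun v0 (v1 : H) => ten (f u0 v0) (u1 * v1)).
Proof. exact: bilin_comp (ten_bilin _ _) (bf.2 u0) ((algmul_bilin H).2 u1). Qed.

Let out (q : tens V H) :
  bilin (fun u0 (u1 : H) => tlift (fun v0 v1 => ten (f u0 v0) (u1 * v1)) q).
Proof.
apply: bilin_tlift_fun => v0 v1.
exact: bilin_comp (ten_bilin _ _) (bf.1 v0) ((algmul_bilin H).1 v1).
Qed.

Lemma diag_bilin : bilin (diag f).
Proof.
split=> [q|p]; first exact/tlift_linear/out.
by apply: linear_tlift_fun => u0 u1; exact/tlift_linear/in1.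
Qed.

Lemma diag_tenl u0 u1 q :
  diag f (ten u0 u1) q = tlift (fun v0 v1 => ten (f u0 v0) (u1 * v1)) q.
Proof. by rewrite /diag tlift_ten. Qed.

Lemma diag_ten u0 u1 v0 v1 :
  diag f (ten u0 u1) (ten v0 v1) = ten (f u0 v0) (u1 * v1).
Proof. by rewrite diag_tenl tlift_ten. Qed.

End Diagonal.

Lemma tmap_diag (U V W X : lmodType k) (f : U -> V -> W) (g : W -> X) p q :
  bilin f -> linear g ->
  tmap g id (diag f p q) = diag (fun u v => g (f u v)) p q.
Proof.
move=> bf lg; have lgi : linear (tmap g (@id H)) by exact: tmap_linear.
move: p q; apply: bilin_tens_ext => [||u v x y].
- exact: linear_bilin lgi (diag_bilin bf).
- exact: diag_bilin (linear_bilin lg bf).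
by rewrite !diag_ten ?tmap_ten //; exact: linear_bilin.
Qed.

Lemma coequivariant_of_morph (U V W : lmodType k) (rhoU : U -> tens U H)
    (rhoV : V -> tens V H) (rhoW : W -> tens W H) (f : U -> V -> W) :
  hcomodule rhoU -> hcomodule rhoV -> bilin f ->
  hcomod_morph (tens_coact rhoU rhoV) rhoW (tlift f) ->
  coequivariant rhoU rhoV rhoW f.
Proof.
move=> hU hV bf [lf mf] u v; have bt := ten_bilin U V.
rewrite -(tlift_ten u v bf) mf /tens_coact tlift_ten; last first.
  exact: bilin_comp (diag_bilin bt) (coact_linear hU) (coact_linear hV).
rewrite -/(diag (@ten k U V) _ _) tmap_diag //.
move: (rhoU u) (rhoV v); apply: bilin_tens_ext => [||a b c d].
- exact: diag_bilin (linear_bilin lf bt).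
- exact: diag_bilin.
by rewrite !diag_ten ?tlift_ten //; exact: linear_bilin.
Qed.

(** Same cancellation as in [equivariant_adjoint]: the right-hand side is
f(u_0, v_0) (x) u_1 v_1 S(v_2).  It depends linearly on the tensor
u_0 (x) u_1, which may therefore be taken to be pure. *)
Lemma coequivariant_adjoint (U V W : lmodType k) (rhoU : U -> tens U H)
    (rhoV : V -> tens V H) (rhoW : W -> tens W H) (f : U -> V -> W) u v :
  hcomodule rhoV -> bilin f -> coequivariant rhoU rhoV rhoW f ->
  tmap (f^~ v) id (rhoU u) =
  tlift (fun v0 v1 =>
    tlift (fun w0 w1 => ten w0 (w1 * antipode v1)) (rhoW (f u v0))) (rhoV v).
Proof.
move=> hV bf ef; have lr := coact_linear hV.
have lS : linear (@antipode k H) by exact: lfun_linear.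
have bm := algmul_bilin H.
have brm c : bilin (fun (w0 : W) (w1 : H) => ten w0 (w1 * antipode c)).
  exact: bilin_comp (ten_bilin _ _) (@linear_id k W) (bm.1 _).
under [RHS]eq_tlift => v0 v1 do rewrite ef.
move: (rhoU u); apply: tens_linear_ext => [||u0 u1].
- by apply: tmap_linear => //; exact: bf.1.
- apply: linear_tlift_fun => v0 v1.
  exact: linear_comp (tlift_linear (brm v1)) ((diag_bilin bf).1 _).
rewrite tmap_ten //; last exact: bf.1.
pose F a b c := ten (f u0 a) (u1 * b * antipode c).
have tF : trilin F.
  split=> [c|a b].
    apply: bilin_comp (ten_bilin _ _) (bf.2 u0) _.
    exact: linear_comp (bm.1 _) (bm.2 u1).
  exact: linear_comp ((ten_bilin _ _).2 _) (linear_comp (bm.2 _) lS).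
transitivity (tlift (fun a c => tlift (F a) (comul c)) (rhoV v)); last first.
  rewrite -(tlift_coassoc lr _ (coactA hV v) tF); last exact: lfun_linear.
  apply: eq_tlift => v0 v1.
  rewrite diag_tenl // (linear_tlift _ _ (tlift_linear (brm v1))).
  by apply: eq_tlift => a b; rewrite tlift_ten.
have inner a c : tlift (F a) (comul c) = ten (f u0 ((counit c : k) *: a)) u1.
  transitivity
    (ten (f u0 a) (u1 * tlift (fun b c => b * antipode c) (comul c))).
    have l1 := linear_comp ((ten_bilin W H).2 (f u0 a)) (bm.2 u1).
    rewrite (linear_tlift _ _ l1); apply: eq_tlift => b d.
    by rewrite /F mulrA.
  rewrite antipoder -scalerAr mulr1 (linear_scale _ _ (bf.2 u0)).
  rewrite (linear_scale _ _ ((ten_bilin _ _).2 _)).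
  by rewrite (linear_scale _ _ ((ten_bilin _ _).1 _)).
rewrite (eq_tlift _ inner) -{1}(coact_counit hV v).
by rewrite (linear_tlift _ _ (linear_comp ((ten_bilin _ _).1 u1) (bf.2 u0))).
Qed.

Lemma coequivariant_adjoint0 (U V W : lmodType k) (rhoU : U -> tens U H)
    (rhoV : V -> tens V H) (rhoW : W -> tens W H) (f : U -> V -> W) u v :
  hcomodule rhoV -> bilin f -> coequivariant rhoU rhoV rhoW f ->
  linear rhoW -> (forall v, f u v = 0) -> tmap (f^~ v) id (rhoU u) = 0.
Proof.
move=> hV bf ef lW fu0; rewrite (coequivariant_adjoint _ _ hV bf ef).
apply: tlift_eq0 => v0 v1.
rewrite fu0 (linear_map0 lW) (linear_map0 (f := tlift _)) //; apply: tlift_linear.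
exact: bilin_comp (ten_bilin _ _) (@linear_id k W) ((algmul_bilin H).1 _).
Qed.

Lemma quotient_hcomodule (M V : lmodType k) (rhoM : M -> tens M H)
    (p : M -> V) :
  hcomodule rhoM -> linear p -> (forall v, exists m, p m = v) ->
  (forall m, p m = 0 -> tmap p id (rhoM m) = 0) ->
  exists2 rhoV : V -> tens V H, hcomodule rhoV & hcomod_morph rhoM rhoV p.
Proof.
move=> hM lp sp kp; have [s ps] := choice sp; have lM := coact_linear hM.
have lpi : linear (tmap p (@id H)) by exact: tmap_linear.
pose rhoV v := tmap p (@id H) (rhoM (s v)).
have rhoVE m : rhoV (p m) = tmap p id (rhoM m).
  apply/eqP; rewrite -subr_eq0 -(linear_mapB _ _ lpi) -(linear_mapB _ _ lM).
  by apply/eqP/kp; rewrite (linear_mapB _ _ lp) ps subrr.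
have lV : linear rhoV.
  by move=> a u v; rewrite -[u]ps -[v]ps -lp !rhoVE lM lpi.
have lc : linear (@comul k H) by exact: lfun_linear.
exists rhoV; last by split=> // m; rewrite rhoVE.
split=> [//|v|v]; rewrite -[v]ps !rhoVE.
  rewrite !tmap_comp //= (eq_tmap (g' := id) _ rhoVE) //.
  rewrite -(tmap_comp (f := tmap p id) (g := id) (f' := rhoM) (g' := id)) //.
  rewrite tassoc_tmap // (coactA hM) tmap_comp //; last exact: tmap_linear.
  by apply: eq_tmap => // h; rewrite tmap_id.
rewrite -{2}[s v](coact_counit hM) (linear_tlift _ _ lp) tlift_tmap //.
  by apply: eq_tlift => a b; rewrite (linear_scale _ _ lp).
apply: bilin_swap; apply: (bilin_comp (@scale_bilin k V)) => //.
exact: lfun_linear.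
Qed.

Section Coaction.
Variables (L : lmodType k) (rho : L -> tens L H).
Hypothesis hL : hcomodule rho.
Local Notation rhoT := (tensalg_coact rho).

Let lT := coact_linear (tensalg_hcomodule hL).
Let lL := coact_linear hL.

Let word_coact_multilin : multilin (word_coact rho).
Proof.
move=> s1 s2 a x y; elim: s1 => [|z s1 IHs] /=.
  by rewrite lL; exact: (diag_bilin (tcons_bilin L)).1.
by rewrite IHs; exact: (diag_bilin (tcons_bilin L)).2.
Qed.

Let rhoT_word s : rhoT (word s) = word_coact rho s.
Proof. exact: lift_gen word_coact_multilin. Qed.

Lemma tcons_coequivariant : coequivariant rho rhoT rhoT (@tcons k L).
Proof.
move=> x t; move: t; apply: pres_linear_ext => [||s].
- exact: linear_comp lT ((tcons_bilin L).2 x).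
- exact: linear_comp ((diag_bilin (tcons_bilin L)).2 _) lT.
by rewrite -/(word s) tcons_word !rhoT_word.
Qed.

Lemma tact_coequivariant (Z : lmodType k) (rhoZ : Z -> tens Z H)
    (gam : L -> Z -> Z) :
  linear rhoZ -> bilin gam -> coequivariant rho rhoZ rhoZ gam ->
  coequivariant rhoT rhoZ rhoZ (tact gam).
Proof.
move=> lZ bg eg t z; have bt := tact_bilin bg; move: t.
apply: tensalg_ind => [a t u IHt IHu||x t IHt].
- by rewrite bt.1 lZ IHt IHu lT (diag_bilin bt).1.
- rewrite rhoT_word tact_word //= diag_tenl // -{1}[rhoZ z]tmap_id.
  by apply: eq_tlift => z0 z1; rewrite tact_word // mul1r.
rewrite tact_tcons // eg IHt tcons_coequivariant.
move: (rho x) (rhoT t) (rhoZ z) => p q r; have bc := tcons_bilin L.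
pose G a b c := diag gam a (diag (tact gam) b c).
move: p q; apply: bilin_tens_ext => [||x0 x1 t0 t1].
- exact: bilin_comp (diag_bilin bg) (@linear_id k _) ((diag_bilin bt).1 r).
- exact: (linear_bilin ((diag_bilin bt).1 r) (diag_bilin bc)).
rewrite diag_ten //; move: r; apply: tens_linear_ext => [||z0 z1].
- exact: linear_comp ((diag_bilin bg).2 _) ((diag_bilin bt).2 _).
- exact: (diag_bilin bt).2.
by rewrite !diag_ten // tact_tcons // mulrA.
Qed.

(** Applying t |-> (t acting on V) to the coaction of a tensor t gives the
coaction of the endomorphism t, which is characterized by [end_coactP]. *)
Lemma hcomod_tracial_trace_invariant (V : vectType k) (rhoV : V -> tens V H)
    (bet : L -> V -> V) t :
  hcomodule rhoV -> bilin bet -> coequivariant rho rhoV rhoV bet ->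
  hcomod_tracial rhoV ->
  triv_coact H (tact_trace bet t) =
  tmap (tact_trace bet) id (rhoT t).
Proof.
move=> hV bb eb [ltr trV]; rewrite trV; have bt := tact_bilin bb.
have lo := tact_lfun_linear bb.
rewrite -(tmap_comp (f := @endtr k V) (g := id)
  (f' := fun t => linfun (tact bet t)) (g' := id)) //.
congr tmap; apply/esym/(end_coactP hV) => v.
rewrite tmap_comp //; last exact: ev_linear.
rewrite (eq_tmap (f' := fun t => tact bet t v) (g' := id)) => [|u|//]; last first.
  by rewrite linfun_linearE //; exact: bt.2.
rewrite (coequivariant_adjoint _ _ hV bt
  (tact_coequivariant (coact_linear hV) bb eb)).
by apply: eq_tlift => v0 v1; rewrite linfun_linearE //; exact: bt.2.
Qed.

End Coaction.

(** The roles of V, v0, Z and ev are those of [hmod_trace_radical_invariant];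
the coordinates of ev(-, z) provide the functionals that detect 0 in V (x) H. *)
Lemma hcomod_trace_radical_coinvariant (L : vectType k) (rho : L -> tens L H)
    (Z : vectType k) (rhoZ : Z -> tens Z H) (gam : L -> Z -> Z)
    (V : vectType k) (bet : L -> V -> V) (v0 : V) (ev : V -> Z -> Z) :
  hcomodule rho -> hcomod_cohereditarily_tracial (tensalg_coact rho) ->
  hcomodule rhoZ -> bilin gam -> coequivariant rho rhoZ rhoZ gam ->
  bilin bet -> (forall v, exists t, tact bet t v0 = v) ->
  bilin ev -> (forall t z, ev (tact bet t v0) z = tact gam t z) ->
  (forall v, (forall z, ev v z = 0) -> v = 0) ->
  forall x, (forall t, tact_trace bet (tcons x t) = 0) ->
  forall t,
  contract (fun y => tact_trace bet (tcons y t)) (rho x) = 0.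
Proof.
move=> hL trT hZ bg eg bb surj bev evE ev0 x x0 t.
have hT := tensalg_hcomodule hL; have bt := tact_bilin bb.
have bV0 : linear (fun t => tact bet t v0) := bt.1 v0.
have lZ := coact_linear hZ; have btg := tact_bilin bg.
have kp t' : tact bet t' v0 = 0 ->
    tmap (fun t => tact bet t v0) id (tensalg_coact rho t') = 0.
  move=> t'0; set u := tmap _ _ _.
  pose fam (f : V -> k^o) :=
    exists z i, f = fun v => coord (vbasis {:Z}) i (ev v z).
  have [s ->] : supported u 0%VS.
    apply: (supported_kernels (P := fam)) => [_ [z [i ->]]|v fv].
      have le := bev.1 z.
      have lc : linear (fun z => coord (vbasis {:Z}) i z : k^o).
        exact: lfun_linear.
      split; first exact: linear_comp lc le.
      rewrite contractE; last exact: linear_comp lc le.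
      rewrite -(tmap_comp (f := fun z => coord (vbasis {:Z}) i z : k^o)
        (g := id) (f' := fun v => ev v z) (g' := id)) //.
      rewrite /u (tmap_comp (f := fun v => ev v z)) //.
      rewrite (eq_tmap (f' := fun t => tact gam t z) (g' := id)) => [|w|//];
        last by rewrite evE.
      rewrite (coequivariant_adjoint0 _ hZ btg
        (tact_coequivariant hL lZ bg eg) lZ).
        rewrite (linear_map0 (f := tmap _ _)); last exact: tmap_linear.
        rewrite (linear_map0 (f := tlift _)) //.
        exact/tlift_linear/scale_bilin.
      by move=> w; rewrite -evE t'0 (linear_map0 (bev.1 w)).
    rewrite memv0; apply/eqP/ev0 => z; rewrite (coord_vbasis (memvf (ev v z))).
    apply: big1 => i _.
    rewrite (fv (fun v => coord (vbasis {:Z}) i (ev v z))) ?scale0r //.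
    by exists z, i.
  rewrite (eq_tmap (f' := fun=> 0) (g' := id)) => [|w|//]; last first.
    by apply/eqP; rewrite -memv0; exact: subvsP.
  by apply: tlift_eq0 => a h; rewrite (linear_map0 ((ten_bilin _ _).1 _)).
have [rhoV hV mp] := quotient_hcomodule hT bV0 surj kp.
have eb : coequivariant rho rhoV rhoV bet.
  move=> y v; have [u <-] := surj v.
  rewrite -tact_tcons // mp.2 (tcons_coequivariant hL) mp.2.
  rewrite (tmap_diag _ _ (tcons_bilin L) bV0).
  move: (rho y) (tensalg_coact rho u); apply: bilin_tens_ext => [||a b c d].
  - exact: diag_bilin (linear_bilin bV0 (tcons_bilin L)).
  - apply: bilin_comp (diag_bilin bb) (@linear_id k _) _.
    exact: tmap_linear.
  rewrite tmap_ten // !diag_ten ?tact_tcons //.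
  exact: linear_bilin bV0 (tcons_bilin L).
have trV := trT _ _ hV _ mp surj.
pose g y u : k^o := tact_trace bet (tcons y u).
have ltr := tact_trace_linear bb.
have bgg : bilin g := linear_bilin ltr (tcons_bilin L).
have egg : coequivariant rho (tensalg_coact rho) (@triv_coact k H) g.
  move=> y u; rewrite /g (hcomod_tracial_trace_invariant hL _ hV bb eb trV).
  by rewrite (tcons_coequivariant hL) (tmap_diag _ _ (tcons_bilin L) ltr).
rewrite contractE; last exact: bgg.1.
rewrite (coequivariant_adjoint0 _ hT bgg egg);
  [|exact: (ten_bilin _ _).1|exact: x0].
by rewrite (linear_map0 (f := tlift _)) //; exact/tlift_linear/scale_bilin.
Qed.

End ComoduleCase.

(** * Traces of nilpotent and idempotent operators *)
Section MatrixTrace.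
Variable k : fieldType.

(** With T the indeterminate, det(T - X) divides det(T^m - X^m), which is a
power of T because X^m = 0; so the characteristic polynomial is a power of T. *)
Lemma nilpotent_mx_trace0 n (X : 'M[k]_n) m : X ^+ m = 0 -> \tr X = 0.
Proof.
case: n X => [|n] X Xm0; first by rewrite /mxtrace big_ord0.
have /dvdp_exp_XsubCP [d _] :
    char_poly X %| ('X - (0 : k)%:P) ^+ (n.+1 * m).
  pose Y := map_mx polyC X; pose Z : 'M[{poly k}]_n.+1 := 'X%:M.
  have Ym0 : Y ^+ m = 0 by rewrite -rmorphXn /= Xm0 rmorph0.
  have cZY : GRing.comm Z Y by apply/commr_sym/comm_mx_scalar.
  have detX : \det (Z ^+ m) = ('X ^+ n.+1) ^+ m.
    rewrite -(det_scalar n.+1).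
    elim: (m) => [|i IHi]; first by rewrite !expr0 det1.
    by rewrite [in LHS]exprS [LHS](det_mulmx Z (Z ^+ i)) IHi exprS.
  rewrite subr0 exprM -detX -[Z ^+ m]subr0 -Ym0 subrXX_comm //.
  by rewrite -mulmxE det_mulmx; exact: dvdp_mulr.
rewrite subr0 eqp_monic ?char_poly_monic ?monicXn // => /eqP chiX.
have := char_poly_trace X isT; rewrite chiX coefXn /=.
have -> : d = n.+1.
  by have := size_char_poly X; rewrite chiX size_polyXn => -[].
by rewrite ltn_eqF // => /eqP; rewrite eq_sym oppr_eq0 => /eqP.
Qed.

(** In a rank factorization E = C R with E^2 = E one has R C = 1. *)
Lemma idempotent_mx_trace n (E : 'M[k]_n) :
  E *m E = E -> \tr E = (\rank E)%:R.
Proof.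
move=> EE; rewrite -{1}(mulmx_base E) mxtrace_mulC.
suff -> : row_base E *m col_base E = 1%:M by rewrite mxtrace1.
apply: (row_full_inj (col_base_full E)).
apply: (row_free_inj (row_base_free E)).
by rewrite mulmx1 (mulmxA (col_base E)) mulmx_base -mulmxA mulmx_base.
Qed.

(** With T the indeterminate, write the annihilating polynomial T * char_poly X
as T^a * r with r nonzero at 0, and let e = u T^a with u T^a + v r = 1.  Then
e(X) is the projection onto the Fitting component on which X is invertible, and
it has trace 0 as a combination of positive powers of X.  Its rank is at most n,
so it vanishes in k only if e(X) = 0, and then X^a = 0. *)
Lemma power_traces0_nilpotent n (X : 'M[k]_n) :
  (forall p : nat, p \in [pchar k] -> (n < p)%N) ->
  (forall i, \tr (X ^+ i.+1) = 0) -> exists m, X ^+ m = 0.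
Proof.
case: n X => [|n] X chark trX; first by exists 0%N; rewrite [LHS]thinmx0.
(* the extra factor makes a > 0, so that e has no constant term *)
pose chi := 'X * char_poly X.
have chi_n0 : chi != 0.
  by rewrite mulf_neq0 ?polyX_eq0 ?monic_neq0 ?char_poly_monic.
have chiX0 : horner_mx X chi = 0.
  by rewrite rmorphM /= Cayley_Hamilton mulr0.
have [a [r r0 def_chi]] := multiplicity_XsubC chi 0.
rewrite chi_n0 /= in r0; rewrite subr0 in def_chi.
have a_gt0 : (0 < a)%N.
  case: a def_chi => // def_chi; move: r0.
  by rewrite -[r]mulr1 -[r * 1]def_chi rootM rootX eqxx.
have cop : coprimep ('X^a) r.
  by rewrite coprimep_expl // coprimep_sym coprimepX.
have [[u v] /= uv] := elimT (Bezout_eq1_coprimepP _ _) cop.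
pose e := u * 'X^a.
have eX2 : horner_mx X e *m horner_mx X e = horner_mx X e.
  apply/eqP; rewrite -subr_eq0 -{3}[horner_mx X e]mulr1 mulmxE -mulrBr.
  have -> : 1 = horner_mx X 1 by rewrite rmorph1.
  rewrite -rmorphB -rmorphM -uv opprD addrA subrr add0r /=.
  have -> : e * - (v * r) = - (u * v) * chi.
    by rewrite def_chi /e mulrN mulNr mulrACA (mulrC r).
  by rewrite rmorphM /= chiX0 mulr0.
have tre : \tr (horner_mx X e) = 0.
  have -> : e = \sum_(i < size u) u`_i *: 'X^(i + a).
    rewrite /e -{1}(coefK u) poly_def mulr_suml; apply: eq_bigr => i _.
    by rewrite -scalerAl -exprD.
  rewrite rmorph_sum raddf_sum big1 // => i _ /=.
  rewrite -mul_polyC rmorphM /= horner_mx_C rmorphXn /= horner_mx_X.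
  rewrite -mulmxE mul_scalar_mx mxtraceZ -(prednK a_gt0) addnS trX mulr0 //.
have re0 : horner_mx X e = 0.
  apply/eqP; rewrite -mxrank_eq0; apply/negPn/negP; rewrite -lt0n => rk_gt0.
  have := idempotent_mx_trace eX2; rewrite tre => /esym /eqP rk0.
  have [p pk] := natf0_pchar rk_gt0 rk0.
  move: rk0; rewrite -(dvdn_pcharf pk) => /(dvdn_leq rk_gt0) le_p.
  have := chark p pk; rewrite ltnNge => /negP; apply.
  exact: leq_trans le_p (rank_leq_row _).
exists a; rewrite -[X ^+ a]mul1r.
have -> : X ^+ a = horner_mx X 'X^a by rewrite rmorphXn /= horner_mx_X.
have -> : 1 = horner_mx X 1 by rewrite rmorph1.
rewrite -uv -rmorphM mulrDl rmorphD /= rmorphM /= re0 mul0r add0r.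
have -> : v * r * 'X^a = v * chi by rewrite def_chi mulrA.
by rewrite rmorphM /= chiX0 mulr0.
Qed.

End MatrixTrace.

Section EndoTrace.
Variables (k : fieldType) (V : vectType k).
Implicit Types f g : 'End(V).
Local Notation e := (vbasis {:V}).
Local Notation mat f := (passmx.mxof e e f).

Lemma endtr_comp_comm f g : endtr (f \o g)%VF = endtr (g \o f)%VF.
Proof.
by rewrite /endtr !(passmx.mxof_comp _ _ (vbasisP _)) mxtrace_mulC.
Qed.

Let rVof_iter f m v :
  passmx.rVof e (iter m f v) = passmx.rVof e v *m mat f ^+ m.
Proof.
elim: m => [|m IHm]; first by rewrite expr0 mulmx1.
rewrite iterS (passmx.rVof_app _ (vbasisP _)) IHm -mulmxA exprSr //.
Qed.

Let mat_iter f g m : (forall v, g v = iter m f v) -> mat g = mat f ^+ m.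
Proof.
move=> gE; apply/row_matrixP => i; rewrite !rowE passmx.mul_mxof gE rVof_iter.
by rewrite passmx.vecofK // vbasisP.
Qed.

Lemma nilpotent_endtr0 f m : (forall v, iter m f v = 0) -> endtr f = 0.
Proof.
move=> f0; apply: (@nilpotent_mx_trace0 k _ _ m).
rewrite -(mat_iter (g := 0)) => [|v]; last by rewrite f0 zero_lfunE.
by apply/eqP; rewrite (passmx.mxof_eq0 (vbasisP _) (vbasisP _)).
Qed.

Lemma power_endtr0_nilpotent f :
  (forall p : nat, p \in [pchar k] -> (\dim {:V} < p)%N) ->
  (forall i g, (forall v, g v = iter i.+1 f v) -> endtr g = 0) ->
  exists m, forall v, iter m f v = 0.
Proof.
move=> chark f0.
have lin i : linear (iter i f).
  by elim: i => // i IHi a x y; rewrite !iterS IHi linearP.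
have [i|m fm0] := power_traces0_nilpotent (X := mat f) chark.
  have gE v : linfun (iter i.+1 f) v = iter i.+1 f v by rewrite linfun_linearE.
  by rewrite -(mat_iter gE); exact: f0 gE.
exists m => v; apply/eqP; rewrite -(passmx.rVof_eq0 (vbasisP {:V})).
by rewrite rVof_iter fm0 mulmx0.
Qed.

End EndoTrace.

(** Turns a subspace given by a property into a value of type vspace, by
taking a largest subspace on which the property holds. *)
Lemma exists_vspace_pred (k : fieldType) (V : vectType k) (P : V -> Prop) :
  P 0 -> (forall a u v, P u -> P v -> P (a *: u + v)) ->
  exists W : {vspace V}, forall v, v \in W <-> P v.
Proof.
move=> P0 Plin.
have [||W [WP Wmax]] :=
    @exists_greatest_vspace k V (fun W => forall v, v \in W -> P v).
- by move=> v; rewrite memv0 => /eqP ->.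
- move=> U W UP WP _ /memv_addP[u uU [w wW ->]].
  by rewrite -[u]scale1r; apply: Plin; [exact: UP|exact: WP].
exists W => v; split=> [|Pv]; first exact: WP.
suff /Wmax/subvP-> : forall w, w \in <[v]>%VS -> P w by rewrite ?memv_line.
by move=> _ /vlineP[a ->]; rewrite -[_ *: _]addr0; exact: Plin.
Qed.

(** * The trace form of the adjoint algebra and the nilradical *)
Section AdjointAlgebra.
Variables (k : fieldType) (L : lieAlg k).
Local Notation A := (ad_alg L).
Local Notation V := (subvs_of A).
Implicit Types (x y z : L) (f g : 'End(L)) (I U W : {vspace L}).

Lemma ad_alg1 : \1%VF \in A.
Proof. by case: (ad_algP L) => -[]. Qed.

Lemma ad_algM f g : f \in A -> g \in A -> (f \o g)%VF \in A.
Proof. by case: (ad_algP L) => -[_ + _] _; apply. Qed.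

Lemma ad_alg_ad x : ad x \in A.
Proof. by case: (ad_algP L) => -[]. Qed.

Lemma ad_linear : linear (@ad k L).
Proof.
move=> a x y; apply/lfunP => z.
by rewrite add_lfunE scale_lfunE !adE (bracket_bilin L).1.
Qed.

Lemma ad_bracket x y : ad (bracket x y) = (ad x \o ad y)%VF - (ad y \o ad x)%VF.
Proof.
apply/lfunP => z; rewrite add_lfunE opp_lfunE !comp_lfunE !adE jacobi_der.
by rewrite addrK.
Qed.

(** A property that holds on ad(L) and 1 and is preserved by linear combinations
and products defines a subalgebra, which contains A by minimality. *)
Lemma ad_alg_ind (P : 'End(L) -> Prop) :
  (forall a f g, P f -> P g -> P (a *: f + g)) -> P \1%VF ->
  (forall f g, P f -> P g -> P (f \o g)%VF) -> (forall x, P (ad x)) ->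
  forall f, f \in A -> P f.
Proof.
move=> Plin P1 PM Pad.
have P0 : P 0 by rewrite -(addNr \1%VF) -scaleN1r; exact: Plin.
have [B BP] := exists_vspace_pred P0 Plin.
have /subvP AB : (A <= B)%VS.
  apply: (ad_algP L).2; split=> [|f g /BP Pf /BP Pg|x]; apply/BP => //.
  exact: PM.
by move=> f /AB/BP.
Qed.

Lemma ad_alg_ideal I f y : lie_ideal I -> f \in A -> y \in I -> f y \in I.
Proof.
move=> /lie_idealP iI fA; move: f fA y; apply: ad_alg_ind.
- move=> a f g fI gI y yI.
  by rewrite add_lfunE scale_lfunE memvD ?memvZ ?fI ?gI.
- by move=> y; rewrite id_lfunE.
- by move=> f g fI gI y yI; rewrite comp_lfunE fI ?gI.
- by move=> x y yI; rewrite adE iI.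
Qed.

Definition lmul f : 'End(V) := linfun (fun b : V => vsproj A (f \o vsval b)%VF).

Lemma lmulE f (b : V) : f \in A -> vsval (lmul f b) = (f \o vsval b)%VF.
Proof.
move=> fA; rewrite linfun_linearE ?vsprojK ?ad_algM ?subvsP //.
by move=> a u v; rewrite linearP comp_lfunDr -comp_lfunZr linearP.
Qed.

Lemma lmul_comp f g : f \in A -> g \in A ->
  lmul (f \o g)%VF = (lmul f \o lmul g)%VF.
Proof.
move=> fA gA; apply/lfunP => b; apply: val_inj.
by rewrite comp_lfunE /= !lmulE ?ad_algM // comp_lfunA.
Qed.

Lemma iter_lmul f m (b : V) y : f \in A ->
  vsval (iter m (lmul f) b) y = iter m f (vsval b y).
Proof.
by move=> fA; elim: m => //= m IHm; rewrite lmulE // comp_lfunE IHm.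
Qed.

Definition reg_trace f : k^o := endtr (lmul f).

Lemma reg_trace_linear : linear reg_trace.
Proof.
move=> a f g; rewrite /reg_trace -endtr_linear; congr endtr.
apply/lfunP => b; rewrite add_lfunE scale_lfunE !linfun_linearE;
  try by move=> c u v; rewrite linearP comp_lfunDr -comp_lfunZr linearP.
by rewrite comp_lfunDl -comp_lfunZl linearP.
Qed.

Lemma reg_trace_comm f g : f \in A -> g \in A ->
  reg_trace (f \o g)%VF = reg_trace (g \o f)%VF.
Proof. by move=> fA gA; rewrite /reg_trace !lmul_comp // endtr_comp_comm. Qed.

(** The radical of the trace form (f, g) |-> tau(f g) on A. *)
Definition trace_radical f : Prop :=
  f \in A /\ forall b, b \in A -> reg_trace (f \o b)%VF = 0.

Lemma trace_radical_linear a f g :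
  trace_radical f -> trace_radical g -> trace_radical (a *: f + g).
Proof.
move=> [fA f0] [gA g0]; split=> [|b bA]; first by rewrite memvD ?memvZ.
by rewrite comp_lfunDl -comp_lfunZl reg_trace_linear f0 // g0 // scaler0 addr0.
Qed.

Lemma trace_radical0 : trace_radical 0.
Proof.
split=> [|b bA]; first exact: mem0v.
by rewrite comp_lfun0l (linear_map0 reg_trace_linear).
Qed.

Lemma trace_radicalMl g f :
  g \in A -> trace_radical f -> trace_radical (g \o f)%VF.
Proof.
move=> gA [fA f0]; split=> [|b bA]; first exact: ad_algM.
by rewrite -comp_lfunA reg_trace_comm ?ad_algM // -comp_lfunA f0 ?ad_algM.
Qed.

Lemma trace_radicalMr g f :
  g \in A -> trace_radical f -> trace_radical (f \o g)%VF.
Proof.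
move=> gA [fA f0]; split=> [|b bA]; first exact: ad_algM.
by rewrite -comp_lfunA f0 ?ad_algM.
Qed.

Hypothesis hchar : forall p : nat, p \in [pchar k] -> (\dim A < p)%N.

(** The trace of the (i+1)-st power of left multiplication by f is tau(f f^i),
and f is recovered from left multiplication by applying it to 1. *)
Lemma trace_radical_nilpotent f :
  trace_radical f -> exists m, forall y, iter m f y = 0.
Proof.
move=> [fA f0].
have [p pk|i g gE|m fm0] := @power_endtr0_nilpotent k V (lmul f).
- by rewrite dimvf; exact: hchar.
- have [h hA hE] : exists2 h, h \in A & forall b, iter i (lmul f) b = lmul h b.
    elim: i {gE} => [|i [h hA hE]].
      exists \1%VF; first exact: ad_alg1.
      by move=> b; apply: val_inj; rewrite /= lmulE ?ad_alg1 // comp_lfun1l.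
    exists (f \o h)%VF => [|b]; first exact: ad_algM.
    by rewrite iterS hE lmul_comp // comp_lfunE.
  rewrite -(f0 h hA); congr endtr; apply/lfunP => b.
  by rewrite gE iterS hE lmul_comp // comp_lfunE.
exists m => y; have := iter_lmul m (vsproj A \1%VF) y fA.
by rewrite fm0 vsprojK ?ad_alg1 // id_lfunE => <-; rewrite linear0 zero_lfunE.
Qed.

(** A form of Nakayama's lemma.  If W <> 0, take an ideal U of L that is maximal
among those strictly contained in W.  If [x, w] were outside U for some x in I
and w in W, then K w + U, with K the trace radical, would be an ideal strictly
larger than U, hence equal to W.  So w = kap w + u with kap nilpotent, and
iterating gives w in U.  Hence [I, W] is contained in U. *)
Lemma radical_bracket_fixed_ideal0 I W :
  (forall x, x \in I -> trace_radical (ad x)) -> lie_ideal W ->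
  (W <= brackv I W)%VS -> W = 0%VS.
Proof.
move=> IK iW WI; apply/eqP/negPn/negP => W0.
pose P U := lie_ideal U /\ (U <= W)%VS /\ U != W.
pose Q n := `[< exists2 U, P U & \dim U = n >].
have exQ : exists n, Q n.
  exists 0%N; apply/asboolP; exists 0%VS; last exact: dimv0.
  split; last by rewrite sub0v eq_sym.
  apply/lie_idealP => x y; rewrite memv0 => /eqP ->.
  by rewrite -adE linear0 mem0v.
have bdQ n : Q n -> (n <= \dim W)%N.
  by move=> /asboolP[U [_ [UW _]] <-]; exact: dimvS.
case: (ex_maxnP exQ bdQ) => n /asboolP[U [iU [UW UneqW]] dU] maxU.
have /negP := UneqW; apply; rewrite eqEsubv UW /=.
apply: subv_trans WI _; apply/brackvP => x w xI wW.
apply/negPn/negP => xwU.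
pose R v := exists kap u, [/\ trace_radical kap, u \in U & v = kap w + u].
have [||J JR] := @exists_vspace_pred k L R.
- exists 0, 0; split; [exact: trace_radical0|exact: mem0v|].
  by rewrite zero_lfunE addr0.
- move=> a _ _ [k1 [u1 [k1K u1U ->]]] [k2 [u2 [k2K u2U ->]]].
  exists (a *: k1 + k2), (a *: u1 + u2); split.
  + exact: trace_radical_linear.
  + by rewrite memvD ?memvZ.
  + by rewrite add_lfunE scale_lfunE scalerDr addrACA.
have iJ : lie_ideal J.
  apply/lie_idealP => y _ /JR[kap [u [kapK uU ->]]]; apply/JR.
  exists (ad y \o kap)%VF, (bracket y u); split.
  + exact: trace_radicalMl (ad_alg_ad y) kapK.
  + by move/lie_idealP: iU; apply.
  + by rewrite comp_lfunE -!adE linearD.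
have JW : (J <= W)%VS.
  apply/subvP => _ /JR[kap [u [kapK uU ->]]].
  by rewrite memvD ?(subvP UW u uU) //; apply: ad_alg_ideal => //; case: kapK.
have UJ : (U <= J)%VS.
  apply/subvP => u uU; apply/JR; exists 0, u.
  by split=> //; [exact: trace_radical0|rewrite zero_lfunE add0r].
have xwJ : bracket x w \in J.
  apply/JR; exists (ad x), 0; split; [exact: IK|exact: mem0v|].
  by rewrite adE addr0.
have [JeqW|JneqW] := eqVneq J W; last first.
  have dJU : (\dim J <= \dim U)%N.
    by rewrite dU; apply: maxU; apply/asboolP; exists J.
  have /eqP UeqJ : U == J by rewrite eqEdim UJ.
  by move: xwU; rewrite UeqJ xwJ.
have /JR[kap [u [kapK uU wE]]] : w \in J by rewrite JeqW.
have [m kapm] := trace_radical_nilpotent kapK.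
(* w - kap^i w lies in U for every i *)
have wU : w \in U.
  rewrite -[w]subr0 -(kapm w).
  elim: (m) => [|i IHi]; first by rewrite subrr mem0v.
  rewrite iterS {1}wE addrAC -linearB /= addrC memvD //.
  by apply: ad_alg_ideal => //; case: kapK.
by move: xwU; move/lie_idealP: iU => ->.
Qed.

(** The lower central series of I stabilizes at a term of least dimension, to
which [radical_bracket_fixed_ideal0] applies. *)
Lemma radical_ideal_nilpotent I : lie_ideal I ->
  (forall x, x \in I -> trace_radical (ad x)) -> lie_nilpotent I.
Proof.
move=> iI IK.
have exd : exists d, `[< exists n, \dim (lcs I n) = d >].
  by exists (\dim (lcs I 0)); apply/asboolP; exists 0%N.
case: (ex_minnP exd) => d /asboolP[n dn] mind; exists n.
have iW : lie_ideal (lcs I n) by exact: lie_ideal_lcs.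
apply: (radical_bracket_fixed_ideal0 IK) => //.
suff /eqP -> : brackv I (lcs I n) == lcs I n by exact: subvv.
rewrite eqEdim; apply/andP; split.
  by apply/brackvP => x y _; move/lie_idealP: iW; apply.
by rewrite dn; apply: mind; apply/asboolP; exists n.+1.
Qed.

Lemma mem_nilradicalE x :
  x \in nilradical L <->
  forall b, b \in A -> reg_trace (ad x \o b)%VF = 0.
Proof.
have [[iN [n Nn]] Nmax] := nilradicalP L.
split=> [xN b bA|x0].
  have fA : (ad x \o b)%VF \in A by rewrite ad_algM ?ad_alg_ad.
  have fN m y : iter m.+1 (ad x \o b)%VF y \in lcs (nilradical L) m.
    elim: m => [|m IHm].
      rewrite /= comp_lfunE adE bracketC memvN.
      by move/lie_idealP: iN; apply.
    rewrite iterS comp_lfunE adE; apply: mem_brackv => //.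
    by apply: ad_alg_ideal => //; exact: lie_ideal_lcs.
  apply: (@nilpotent_endtr0 _ _ _ n.+1) => c; apply: val_inj; apply/lfunP => y.
  rewrite iter_lmul // linear0 zero_lfunE; apply/eqP; rewrite -memv0 -Nn.
  exact: fN.
have [||N' N'E] := @exists_vspace_pred k L (fun y => trace_radical (ad y)).
- by rewrite (linear_map0 ad_linear); exact: trace_radical0.
- by move=> a y z; rewrite ad_linear; exact: trace_radical_linear.
have iN' : lie_ideal N'.
  apply/lie_idealP => y z /N'E zK; apply/N'E; rewrite ad_bracket.
  rewrite addrC -scaleN1r; apply: trace_radical_linear.
    exact: trace_radicalMr (ad_alg_ad y) zK.
  exact: trace_radicalMl (ad_alg_ad y) zK.
have /subvP-> // : (N' <= nilradical L)%VS.
  apply: Nmax; split=> //; apply: radical_ideal_nilpotent => // y.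
  by move/N'E.
by apply/N'E; split=> //; exact: ad_alg_ad.
Qed.

End AdjointAlgebra.

(** * The adjoint algebra as a quotient of the tensor algebra *)
Section AdjointQuotient.
Variables (k : fieldType) (L : lieAlg k).
Local Notation A := (ad_alg L).
Local Notation V := (subvs_of A).

Definition ad_mul (x : L) (a : V) : V := lmul (ad x) a.
Definition ad_one : V := vsproj A \1%VF.
Local Notation p t := (tact ad_mul t ad_one).

Lemma ad_mul_bilin : bilin ad_mul.
Proof.
split=> [b a x y|x]; last exact: lfun_linear.
apply: val_inj; rewrite /= /ad_mul !lmulE ?ad_alg_ad // ad_linear.
by rewrite comp_lfunDl -comp_lfunZl.
Qed.

Lemma tact_ad_mulE t b : tact ad_mul t b = lmul (vsval (p t)) b.
Proof.
have bm := tact_bilin ad_mul_bilin; apply: val_inj.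
rewrite /= lmulE ?subvsP //; move: t b; apply: tensalg_ind.
- move=> a t u IHt IHu b; rewrite !bm.1 !linearP /= IHt IHu.
  by rewrite comp_lfunDl -comp_lfunZl.
- move=> b; rewrite !tact_word; try exact: ad_mul_bilin.
  by rewrite /= vsprojK ?ad_alg1 // comp_lfun1l.
move=> x t IHt b; rewrite !tact_tcons; try exact: ad_mul_bilin.
by rewrite /ad_mul !lmulE ?ad_alg_ad // IHt comp_lfunA.
Qed.

Lemma ad_quotient_eval t y : vsval (p t) y = tact (@bracket k L) t y.
Proof.
have bm := tact_bilin ad_mul_bilin; have bb := tact_bilin (bracket_bilin L).
move: t; apply: tensalg_ind => [a t u IHt IHu||x t IHt].
- by rewrite bm.1 bb.1 linearP /= add_lfunE scale_lfunE IHt IHu.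
- rewrite !tact_word; try exact: ad_mul_bilin; try exact: bracket_bilin.
  by rewrite /= vsprojK ?ad_alg1 // id_lfunE.
rewrite !tact_tcons; try exact: ad_mul_bilin; try exact: bracket_bilin.
by rewrite /ad_mul lmulE ?ad_alg_ad // comp_lfunE adE IHt.
Qed.

(** The f for which composition by f on the left preserves the image of TL form
a subalgebra containing ad(L); apply them to the image 1 of the empty word. *)
Lemma ad_quotient_surj (a : V) : exists t, p t = a.
Proof.
have bm := tact_bilin ad_mul_bilin.
suff h f : f \in A -> exists t, vsval (p t) = f.
  by have [t pt] := h _ (subvsP a); exists t; apply: val_inj.
suff h : f \in A -> forall t, exists t', vsval (p t') = (f \o vsval (p t))%VF.
  move=> fA; have [t tE] := h fA (word [::]); exists t.
  rewrite tE tact_word; last exact: ad_mul_bilin.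
  by rewrite vsprojK ?ad_alg1 // comp_lfun1r.
move: f; apply: ad_alg_ind => [a' f g fP gP t||f g fP gP t|x t].
- have [[t1 E1] [t2 E2]] := (fP t, gP t); exists (a' *: t1 + t2).
  by rewrite bm.1 linearP /= E1 E2 comp_lfunDl -comp_lfunZl.
- by move=> t; exists t; rewrite comp_lfun1l.
- have [t1 E1] := gP t; have [t2 E2] := fP t1.
  by exists t2; rewrite E2 E1 comp_lfunA.
exists (tcons x t); rewrite tact_tcons; last exact: ad_mul_bilin.
by rewrite /ad_mul lmulE ?ad_alg_ad.
Qed.

Lemma tact_trace_tcons x t :
  tact_trace ad_mul (tcons x t) = reg_trace (ad x \o vsval (p t))%VF.
Proof.
rewrite /tact_trace; congr endtr; apply/lfunP => b.
rewrite linfun_linearE; last exact: (tact_bilin ad_mul_bilin).2.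
rewrite [LHS]tact_ad_mulE tact_tcons; last exact: ad_mul_bilin.
by rewrite [in LHS]/ad_mul lmulE ?ad_alg_ad.
Qed.

Hypothesis hchar : forall q : nat, q \in [pchar k] -> (\dim A < q)%N.

Lemma mem_nilradical_tensalg x :
  x \in nilradical L <->
  forall t, tact_trace ad_mul (tcons x t) = 0.
Proof.
split=> [/(mem_nilradicalE hchar) x0 t|x0].
  by rewrite tact_trace_tcons x0 ?subvsP.
apply/(mem_nilradicalE hchar) => b bA.
have [t tE] := ad_quotient_surj (vsproj A b).
by have := x0 t; rewrite tact_trace_tcons tE vsprojK.
Qed.

End AdjointQuotient.

(** * Invariance of the nilradical *)
Theorem theorem0p3 (k : fieldType) (H : hopfAlg k) (L : lieAlg k)
    (hchar : forall p : nat, p \in [pchar k] -> (\dim (ad_alg L) < p)%N) :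
  (forall act : H -> L -> L, hmodule_lie act ->
     hmod_cohereditarily_tracial (tensalg_act act) ->
     hinvariant act (nilradical L)) /\
  (forall rho : L -> tens L H, hcomodule_lie rho ->
     hcomod_cohereditarily_tracial (tensalg_coact rho) ->
     hcoinvariant rho (nilradical L)).
Proof.
pose ev (a : subvs_of (ad_alg L)) (y : L) : L := vsval a y.
have bev : bilin ev.
  split=> [y a u v|a]; last exact: lfun_linear.
  by rewrite /ev linearP add_lfunE scale_lfunE.
have ev0 a : (forall y, ev a y = 0) -> a = 0.
  move=> a0; apply: val_inj; apply/lfunP => y.
  by rewrite [LHS]a0 linear0 zero_lfunE.
have bb := bracket_bilin L.
split=> [act [hL eL] trT h x /(mem_nilradical_tensalg hchar) x0|].
  apply/(mem_nilradical_tensalg hchar).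
  have eb := equivariant_of_morph hL hL bb eL.
  exact: (hmod_trace_radical_invariant hL trT hL bb eb (ad_mul_bilin L)
    (@ad_quotient_surj k L) bev (@ad_quotient_eval k L) ev0 h x0).
move=> rho [hL eL] trT x /(mem_nilradical_tensalg hchar) x0.
have eb := coequivariant_of_morph hL hL bb eL.
pose fam (f : L -> k^o) :=
  exists t, f = fun y => tact_trace (@ad_mul k L) (tcons y t).
apply: (supported_kernels (P := fam)) => [_ [t ->]|y fy].
  split.
    apply: linear_comp (tact_trace_linear (ad_mul_bilin L)) _.
    exact: (tcons_bilin L).1.
  apply: (hcomod_trace_radical_coinvariant hL trT hL bb eb (ad_mul_bilin L)
    (@ad_quotient_surj k L) bev (@ad_quotient_eval k L) ev0 x0).
apply/(mem_nilradical_tensalg hchar) => t.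
by apply: (fy (fun y => tact_trace (@ad_mul k L) (tcons y t))); exists t.
Qed.
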